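(* Let $d>2$, let $T_d$ be the $d$-regular tree, let $A$ be a finite nonempty set, and let $(\psi_v)_{v\in V(T_d)}$ be a local symmetric (i.e. $\operatorname{Aut}(T_d)$-invariant) potential such that there is a unique Gibbs measure for it. Let $(X_v)_{v\in V(T_d)}$ be a random process distributed according to this Gibbs measure. Then for any two vertices $u,v$ of $T_d$ at graph distance $k$ from each other, $$I(X_u,X_v)\le c_k\, H(X_v),\qquad\text{where } c_k=\begin{cases}\dfrac{2}{d(d-1)^l} & \text{if } k=2l+1 \text{ is odd},\\[2mm] \dfrac{1}{(d-1)^l} & \text{if } k=2l \text{ is even}.\end{cases}$$
   Context: $V(T_d)$ is the vertex set of $T_d$, $\operatorname{Aut}(T_d)$ its automorphism group, and $\operatorname{Ball}(v,R)$ the ball of radius $R$ around $v$ in the graph distance. For $W\subset V(T_d)$, $\operatorname{pr}_W:A^{V(T_d)}\to A^W$ is the natural projection. $\operatorname{Aut}(T_d)$ acts on $A^{V(T_d)}$ by $(\gamma\omega)(v)=\omega(\gamma^{-1}v)$. A potential is a collection $(\psi_v)_{v\in V(T_d)}$ of functions $\psi_v:A^{V(T_d)}\to\mathbb{R}$. It is local if for every $v$ there are a positive integer $D$ and a function $\psi'_v:A^{\operatorname{Ball}(v,D)}\to\mathbb{R}$ with $\psi_v=\psi'_v\circ\operatorname{pr}_{\operatorname{Ball}(v,D)}$. It is symmetric if $\psi_{\gamma v}(\gamma\omega)=\psi_v(\omega)$ for all $v\in V(T_d)$, $\gamma\in\operatorname{Aut}(T_d)$, $\omega\in A^{V(T_d)}$.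 For a local symmetric potential there is a positive integer $R$ such that every $\psi_v$ depends only on the restriction to $\operatorname{Ball}(v,R)$; fix such an $R$, so $\psi_v$ may be evaluated on elements of $A^W$ for any $W\supset \operatorname{Ball}(v,R)$. For $W\subset V(T_d)$ and a positive integer $r$, $\partial^r W$ is the set of vertices outside $W$ at distance at most $r$ from $W$. For $s\in A^{\Lambda_1}$, $t\in A^{\Lambda_2}$ with $\Lambda_1\cap\Lambda_2=\varnothing$, $s\sqcup t\in A^{\Lambda_1\cup\Lambda_2}$ is their gluing. A Borel probability measure $\mu$ on $A^{V(T_d)}$ is a Gibbs measure for $(\psi_v)$ if for every finite $\Lambda\subset V(T_d)$, every $s\in A^\Lambda$ and $t\in A^{\partial^{2R}\Lambda}$ (with conditioning event of positive probability), $$\Pr\big(\operatorname{pr}_\Lambda(\omega)=s\,\big|\,\operatorname{pr}_{\partial^{2R}\Lambda}(\omega)=t\big)=\frac{\exp\big(-\sum_{v\in\Lambda\cup\partial^R\Lambda}\psi_v(s\sqcup t)\big)}{\sum_{s'\in A^\Lambda}\exp\big(-\sum_{v\in\Lambda\cup\partial^R\Lambda}\psi_v(s'\sqcup t)\big)},$$ where $\omega$ is distributed according to $\mu$. $H$ denotes Shannon entropy, $H(X)=-\sum_q \Pr(X=q)\log\Pr(X=q)$ with $0\log 0=0$, and $I(X,Y)=H(X)+H(Y)-H(X,Y)$ is mutual information. *)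

(* Defs.v *)
From HB Require Import structures.
From mathcomp Require Import all_boot all_order all_algebra.
From mathcomp Require Import all_classical all_reals all_analysis.
Set Implicit Arguments.
Unset Strict Implicit.
Unset Printing Implicit Defensive.
Import Order.TTheory GRing.Theory Num.Theory.
Local Open Scope classical_set_scope.
Local Open Scope ring_scope.

(* Finite nonempty alphabets. The point serves only as the witness of
   nonemptiness that measurable spaces require in this library. *)
#[short(type="pointedFinType")]
HB.structure Definition PointedFinite := {T of Finite T & Pointed T}.

Section Graph.
Variables (V : choiceType) (e : rel V).

Definition walk (x y : V) (n : nat) : Prop :=
  exists p : seq V, [/\ path e x p, last x p = y & size p = n].

(* A simple cycle of length at least 3 is the usual notion of cycle;
   a [ucycle] of size 2 is an edge traversed back and forth. *)
Definition regular_tree (d : nat) : Prop :=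
  [/\ symmetric e, irreflexive e,
      forall x y, exists n, walk x y n,
      forall c : seq V, ucycle e c -> (size c < 3)%N &
      forall x, ([set y | e x y] #= `I_d)%card].

(* Length of a shortest walk; the value 0 for vertices in different components
   never occurs in a connected graph. *)
Definition gdist (x y : V) : nat :=
  if pselect (exists n, `[< walk x y n >]) is left h then ex_minn h else 0%N.

Definition ball_in (v : V) (r : nat) : set V := [set w | (gdist v w <= r)%N].

Definition boundary (r : nat) (W : set V) : set V :=
  [set x | ~ W x /\ exists2 w, W w & (gdist w x <= r)%N].

Definition automorphism (g ginv : V -> V) : Prop :=
  [/\ cancel g ginv, cancel ginv g & {mono g : x y / e x y}].

End Graph.

Section Configurations.
Variables (V : choiceType) (A : Type).

Definition pr (W : set V) (w : V -> A) : W -> A := fun x => w (val x).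

Lemma glue_subproof (W1 W2 : set V) (x : W1 `|` W2) :
  ~ W1 (val x) -> val x \in W2.
Proof. by move=> n1; apply/mem_set; case: (set_mem (valP x)). Qed.

(* The first argument takes precedence on the intersection, which is empty
   wherever this is used. *)
Definition glue (W1 W2 : set V) (s : W1 -> A) (t : W2 -> A) :
    (W1 `|` W2) -> A :=
  fun x => match pselect (W1 (val x)) with
           | left h1 => s (exist _ (val x) (mem_set h1))
           | right n1 => t (exist _ (val x) (glue_subproof n1))
           end.

End Configurations.

(* A^V with the Borel sigma-algebra of the product of discrete topologies. *)
Definition borel_config (V : choiceType) (A : pointedFinType) :=
  @g_sigma_algebraType (V -> A)
    (@open (prod_topology (fun _ : V => discrete_topology A))).

Section Potential.
Variables (R : realType) (V : choiceType) (e : rel V) (A : pointedFinType).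
Variable psi : V -> (V -> A) -> R.

Definition depends_on_ball (v : V) (r : nat) : Prop :=
  exists psi' : (ball_in e v r -> A) -> R,
    psi v = psi' \o @pr V A (ball_in e v r).

Definition local_potential : Prop :=
  forall v, exists2 D : nat, (0 < D)%N & depends_on_ball v D.

Definition symmetric_potential : Prop :=
  forall g ginv, automorphism e g ginv ->
  forall (v : V) (w : V -> A), psi (g v) (w \o ginv) = psi v w.

(* psi_v evaluated on an element of A^W: its value on any configuration
   extending it, all of which agree when W contains Ball(v, r) and psi_v depends
   only on that ball. *)
Definition eval_on (W : set V) (v : V) (w : W -> A) : R :=
  xget 0 [set psi v om | om in [set om | pr (W := W) om = w]].

Definition energy (r : nat) (L : set V)
    (s : L -> A) (t : boundary e r.*2 L -> A) : R :=
  \sum_(v \in L `|` boundary e r L) eval_on v (glue s t).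

Definition cond_prob (mu : probability (borel_config V A) R)
    (E F : set (V -> A)) : R := fine (mu (E `&` F)) / fine (mu F).

Definition gibbs (r : nat) (mu : probability (borel_config V A) R) : Prop :=
  forall (L : set V), finite_set L ->
  forall (s : L -> A) (t : boundary e r.*2 L -> A),
  let F := [set om : V -> A | pr om = t] in
  (0 < mu F)%E ->
  cond_prob mu [set om : V -> A | pr om = s] F =
  expR (- energy s t) / \sum_(s' \in [set: L -> A]) expR (- energy s' t).

Definition unique_gibbs (r : nat) (mu : probability (borel_config V A) R) : Prop :=
  gibbs r mu /\
  forall nu : probability (borel_config V A) R, gibbs r nu ->
    forall B : set (borel_config V A), measurable B -> nu B = mu B.

End Potential.

Section Entropy.
Variables (R : realType) (d : measure_display) (T : measurableType d).
Variable P : probability T R.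

(* The library's [ln 0] is 0, which gives the convention 0 log 0 = 0. *)
Definition entropy (S : finType) (Z : T -> S) : R :=
  - \sum_(q : S) (fine (P (Z @^-1` [set q])) * ln (fine (P (Z @^-1` [set q])))).

Definition mutual_info (S1 S2 : finType) (Y : T -> S1) (Z : T -> S2) : R :=
  entropy Y + entropy Z - entropy (fun x => (Y x, Z x)).

End Entropy.

Definition corr_bound (R : realType) (d k : nat) : R :=
  let l := k./2 in
  if odd k then 2 / (d%:R * (d%:R - 1) ^+ l) else 1 / (d%:R - 1) ^+ l.

(* Main.v *)
From HB Require Import structures.
From mathcomp Require Import fingroup perm action finmap.
Require Import Defs.
From mathcomp Require Import all_boot all_order all_algebra.
From mathcomp Require Import all_classical all_reals all_analysis.
From mathcomp Require Import ring lra zify.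
Set Implicit Arguments.
Unset Strict Implicit.
Unset Printing Implicit Defensive.
Import Order.TTheory GRing.Theory Num.Theory.
Local Open Scope classical_set_scope.

(** Let h be the entropy of one spin and h2 the joint entropy of two spins at
    distance k > 0; the claim is that I = 2 h - h2 is at most [corr_bound] times h.
    It follows from counting colorings of finite graphs.

    Tile the tree by balls of radius l if k = 2 l + 1, two neighboring tiles being
    joined by an edge; if k = 2 l, take balls of radius l - 1 and leave out
    vertices each of which touches d tiles. Call these edges or vertices hubs. A
    hub joins the centers of m tiles, m = 2 or m = d, any two of which are at
    distance k, and a tile touches s hubs, where s is d (d - 1)^l or
    d (d - 1)^(l - 1). In both cases [corr_bound] equals m / (s (m - 1)), see
    [lift_model_ex].

    The same pattern occurs in finite graphs: in a tiled graph of large girth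
    ([pmul_girth]) replace each tile by n copies and glue the copies to n copies of
    the hubs by arbitrary permutations. Every graph so obtained is covered by the
    tree, hence carries a Gibbs measure for psi, which is symmetric. Seen from a
    vertex, this measure satisfies the Gibbs equations of the tree in a large ball
    ([dlr_far_law]), even after conditioning on the color of a far vertex.
    Uniqueness makes all such laws close to mu near the root
    ([uniform_uniqueness]): otherwise a limit of them, finitely additive at first
    and then extended by [kolmogorov], would be another Gibbs measure. Hence colors
    at single vertices and at pairs have almost the laws given by mu, colors at far
    vertices are nearly independent, and color frequencies are concentrated
    ([variance_le]).

    So each of the graphs has a coloring with prescribed local statistics. This is
    possible only if the number of colorings compensates for the improbability that
    random permutations fit a given coloring ([counting]). A coloring of the n
    centers in a class has about exp(n h) possibilities; given it, a random
    permutation produces a given sequence of colors at the hubs with probability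
    about exp(- n h); and the sequences of labels of n hubs number at most
    exp(n (h + (m - 1) (h2 - h))), the entropy of m colors being at most that of a
    star of pairs. Therefore
      s m h <= m h + s (h + (m - 1) (h2 - h)),
    that is, s (m - 1) I <= m h ([edge_vertex_inequality],
    [pair_information_le]). *)

(** * Reduced words and edge colorings of the regular tree *)

Local Open Scope nat_scope.

Section Words.
Variable d : nat.
Implicit Types (c : 'I_d) (w : seq 'I_d).

(** The vertices of the d-regular tree are the elements of the free product of
    d groups of order two, written as reduced words; [lmul c] is multiplication
    by the letter c on the left. *)
Definition reduced w := sorted (fun a b => a != b) w.

Definition lmul c w :=
  if w is c' :: w' then if c == c' then w' else c :: w else [:: c].

Definition act (S : Type) (s : 'I_d -> S -> S) w (y : S) := foldr s y w.

Lemma lmul_reduced c w : reduced w -> reduced (lmul c w).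
Proof.
case: w => [//|c' w'] /=; case: eqP => [_|/eqP ne] rw; first exact: path_sorted rw.
by rewrite /reduced /= ne.
Qed.

Lemma lmulK c w : reduced w -> lmul c (lmul c w) = w.
Proof.
case: w => [|c' w'] /=; first by rewrite eqxx.
case: eqP => [<-|ne] /=; last by rewrite eqxx.
by case: w' => [//|c'' w''] /= /andP[/negbTE ->].
Qed.

Lemma size_lmul c w : size (lmul c w) <= (size w).+1.
Proof. by case: w => [//|c' w'] /=; case: ifP => //= _; lia. Qed.

Lemma size_act_lmul w b : size (act lmul w b) <= size w + size b.
Proof.
by elim: w => //= c w IH; apply: (leq_trans (size_lmul _ _)); rewrite addSn ltnS.
Qed.

Lemma act_reduced w b : reduced b -> reduced (act lmul w b).
Proof. by move=> rb; elim: w => //= c w IH; apply: lmul_reduced. Qed.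

Lemma act_lmul_nil w : reduced w -> act lmul w [::] = w.
Proof.
elim: w => //= c w IH rw; rewrite IH; last exact: path_sorted rw.
by case: w rw {IH} => [//|c' w'] /= /andP[/negbTE ->].
Qed.

Section Action.
Variables (S : Type) (s : 'I_d -> S -> S).

Lemma act_cat w1 w2 y : act s (w1 ++ w2) y = act s w1 (act s w2 y).
Proof. exact: foldr_cat. Qed.

Hypothesis sK : forall c, involutive (s c).

Lemma act_revK w y : act s (rev w) (act s w y) = y.
Proof.
elim: w y => //= c w IH y.
by rewrite rev_cons -cats1 act_cat /= sK IH.
Qed.

Lemma act_Krev w y : act s w (act s (rev w) y) = y.
Proof. by rewrite -{1}(revK w) act_revK. Qed.

Lemma act_lmul c w y : act s (lmul c w) y = s c (act s w y).
Proof. by case: w => [//|c' w'] /=; case: eqP => [<-|//]; rewrite sK. Qed.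

(** Letters act by involutions, so that reducing a word does not change its
    action. *)
Lemma act_act w b y : act s (act lmul w b) y = act s w (act s b y).
Proof. by elim: w => //= c w IH; rewrite act_lmul IH. Qed.

End Action.
End Words.
Arguments lmul {d} c w.

Section Paths.
Variables (V : choiceType) (e : rel V).
Hypothesis acyc : forall c : seq V, ucycle e c -> (size c < 3)%N.
Hypothesis esym : symmetric e.

Lemma mem_split (x : V) (s : seq V) :
  x \in s -> exists p1 p2, s = p1 ++ x :: p2.
Proof. by move=> xs; case/splitPr: xs => p1 p2; exists p1, p2. Qed.

(** From the vertex where the two paths separate, the rest of one path followed
    back along the rest of the other contains a simple path, which that vertex
    closes to a cycle. *)
Lemma uniq_path_unique (x : V) (p q : seq V) :
  path e x p -> path e x q -> uniq (x :: p) -> uniq (x :: q) ->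
  last x p = last x q -> p = q.
Proof.
elim: p x q => [|a p IH] x [|b q] //=.
- by move=> _ _ _ /andP[xq _] lx; rewrite lx mem_last in xq.
- by move=> _ _ /andP[xp _] _ lx; rewrite -lx mem_last in xp.
move=> /andP[exa pa] /andP[exb qb] /andP[xap uap] /andP[xbq ubq] lpq.
have [ab|ab] := eqVneq a b.
  by subst b; rewrite (IH a q).
exfalso; have pab : path e a (p ++ rev (belast b q)).
  rewrite cat_path pa lpq /= (eq_path (e' := fun x y => e y x)); last first.
    by move=> ? ?; apply: esym.
  by rewrite rev_path.
have lab : last a (p ++ rev (belast b q)) = b.
  rewrite last_cat; case: (q) lpq => [|c q'] //=.
  by move=> _; rewrite rev_cons last_rcons.
have xab : x \notin a :: (p ++ rev (belast b q)).
  rewrite -cat_cons mem_cat mem_rev negb_or xap /=.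
  by apply: contra xbq => /mem_belast.
move: lab xab; case/shortenP: pab => r ra ur sr lr xr.
have xr' : x \notin a :: r.
  rewrite inE negb_or; move: xr; rewrite inE negb_or => /andP[-> xr] /=.
  by apply: contra xr => /sr.
have : size (x :: a :: r) < 3.
  apply: acyc; rewrite /ucycle [cycle _ _]/= cons_uniq xr' ur !andbT.
  by rewrite exa rcons_path ra /= lr esym.
by case: (r) lr => //= ab'; rewrite ab' eqxx in ab.
Qed.

End Paths.

(** A proper edge coloring with d colors identifies the vertices with the reduced
    words: [nb c x] is the neighbor of x across the edge of color c, and [word x]
    lists the colors on the way from x to the root u. *)
Definition coloring (V : choiceType) (e : rel V) (d : nat) (u : V)
    (word : V -> seq 'I_d) (nb : 'I_d -> V -> V) : Prop :=
  [/\ injective word, (forall c x, word (nb c x) = lmul c (word x)),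
      (forall x, reduced (word x)), word u = [::] &
      forall x y, e x y <-> exists c, y = nb c x].

Section TreeColoring.
Variables (V : choiceType) (e : rel V) (d : nat).
Hypothesis hT : regular_tree e d.

Let esym : symmetric e. Proof. by case: hT. Qed.
Let eirr : irreflexive e. Proof. by case: hT. Qed.
Let acyc : forall c : seq V, ucycle e c -> (size c < 3)%N. Proof. by case: hT. Qed.

Definition enumerates (x : V) (E : 'I_d -> V) :=
  injective E /\ forall y, e x y <-> exists c, y = E c.

Lemma enumerates_ex x : exists E, enumerates x E.
Proof.
case: hT => _ _ _ _ /(_ x) /card_set_bijP[f [fA finj fsurj]].
have [E EP] : {E : 'I_d -> V & forall c, e x (E c) /\ f (E c) = c :> nat}.
  apply: (@choice _ _ (fun (c : 'I_d) y => e x y /\ f y = c :> nat)) => c.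
  by have [y exy fy] := fsurj c (ltn_ord c); exists y.
exists E; split.
  by move=> a b Eab; apply/val_inj; rewrite /= -(EP a).2 Eab (EP b).2.
move=> y; split=> [exy|[c ->]]; last exact: (EP c).1.
exists (Ordinal (fA y exy)); apply: finj; rewrite ?inE //; first exact: (EP _).1.
by rewrite (EP _).2.
Qed.

(** Prescribed values serve to give the parent of a vertex the color of the edge
    between them, and to lead a given word along a given path. *)
Definition adjusted (xc : V * seq ('I_d * V)) (E : 'I_d -> V) :=
  enumerates xc.1 E /\
    (uniq (unzip1 xc.2) -> uniq (unzip2 xc.2) -> all (e xc.1) (unzip2 xc.2) ->
     forall c y, (c, y) \in xc.2 -> E c = y).

Lemma enumerates_adjust x (cs : seq ('I_d * V)) :
  exists E, enumerates x E /\
    (uniq (unzip1 cs) -> uniq (unzip2 cs) -> all (e x) (unzip2 cs) ->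
     forall c y, (c, y) \in cs -> E c = y).
Proof.
elim: cs => [|[c y] cs [E [[Ei Ee] IH]]].
  by have [E hE] := enumerates_ex x; exists E; split.
have [exy|nxy] := boolP (e x y); last first.
  by exists E; split => // _ _ /=; rewrite (negbTE nxy).
have [c2 yE] := (Ee y).1 exy.
exists (E \o tperm c c2); split.
  split; first exact: inj_comp Ei perm_inj.
  move=> z; rewrite Ee; split=> -[c' ->]; last by exists (tperm c c2 c').
  by exists (tperm c c2 c'); rewrite /= tpermK.
move=> /= /andP[cN u1] /andP[yN u2] /andP[_ a2] c' y'.
rewrite inE => /orP[/eqP[-> ->]|c'y']; first by rewrite tpermL yE.
have Ec' := IH u1 u2 a2 _ _ c'y'.
rewrite tpermD //.
- by apply: contraNneq cN => ->; apply/mapP; exists (c', y').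
- apply: contraNneq yN => c2E; rewrite yE c2E Ec'.
  by apply/mapP; exists (c', y').
Qed.

Lemma gdist_walk x y : walk e x y (gdist e x y).
Proof.
rewrite /gdist; case: pselect => [h|nh].
  by case: ex_minnP => n /asboolP.
exfalso; apply: nh; case: hT => _ _ /(_ x y) [n wn] _ _.
by exists n; apply/asboolP.
Qed.

Lemma gdist_le x y n : walk e x y n -> gdist e x y <= n.
Proof.
move=> wn; rewrite /gdist; case: pselect => [h|nh].
  by case: ex_minnP => m _; apply; apply/asboolP.
by [].
Qed.

Lemma gdist_uniq_path x y :
  exists p, [/\ path e x p, last x p = y, size p = gdist e x y & uniq (x :: p)].
Proof.
have [p [pp lp sp]] := gdist_walk x y.
move: lp; case: (shortenP pp) => q pq uq sq lq.
exists q; split => //; apply/eqP; rewrite eqn_leq; apply/andP; split.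
  rewrite -sp; apply: uniq_leq_size => //; first by case/andP: uq.
by apply: gdist_le; exists q.
Qed.

Section Root.
Variables (u v : V) (w0 : seq 'I_d) (P : seq V).
Hypotheses (w0red : reduced w0) (Ppath : path e u P) (Pv : last u P = v)
  (Psz : size P = size w0) (Puniq : uniq (u :: P)).

Let r := rev w0.

Variable nE : V * seq ('I_d * V) -> ('I_d -> V).
Hypothesis nEP : forall xc, adjusted xc (nE xc).

(** While the path P is being followed along w0, the color of its next vertex is
    imposed. *)
Definition tgt (p : seq 'I_d) : seq ('I_d * V) :=
  if rev p == take (size p) r then
    match drop (size p) r, drop (size p) P with
    | c :: _, y :: _ => [:: (c, y)]
    | _, _ => [::]
    end
  else [::].

(** The vertex reached from u along a word, together with the enumeration of its
    neighbors by colors. *)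
Fixpoint ver (p : seq 'I_d) : V * ('I_d -> V) :=
  if p is c :: p' then
    ((ver p').2 c, nE ((ver p').2 c, (c, (ver p').1) :: tgt p))
  else (u, nE (u, tgt [::])).

Let verE p : enumerates (ver p).1 (ver p).2.
Proof. by case: p => [|c p]; apply: (nEP (_, _)).1. Qed.

Let ver_adj c p : e (ver p).1 (ver (c :: p)).1.
Proof. by apply/(verE p).2; exists c. Qed.

Let rev_take_step c0 i : i < size r ->
  rev (take i.+1 r) = nth c0 r i :: rev (take i r).
Proof. by move=> ir; rewrite (take_nth c0 ir) rev_rcons. Qed.

Definition tgtE c0 i : i < size r -> tgt (rev (take i r)) = [:: (nth c0 r i, nth u P i)].
Proof.
move=> ir; rewrite /tgt revK size_rev size_takel; last exact: ltnW.
rewrite eqxx (drop_nth c0 ir) (drop_nth u) //.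
by rewrite Psz; move: ir; rewrite size_rev.
Qed.

Let rPsz : size r = size P. Proof. by rewrite size_rev. Qed.

Let rnth c0 i : i.+1 < size r -> nth c0 r i != nth c0 r i.+1.
Proof.
move=> ir; rewrite !nth_rev; try by move: ir; rewrite size_rev; lia.
have iw : i.+1 < size w0 by move: ir; rewrite size_rev.
have := w0red => /(sortedP c0) /(_ (size w0 - i.+2)).
have -> : (size w0 - i.+2).+1 = size w0 - i.+1 by lia.
by rewrite eq_sym; apply; lia.
Qed.

Let enodes i : i < size P -> e (nth u (u :: P) i) (nth u P i).
Proof. by move=> iP; move/(pathP u): Ppath; apply. Qed.

Let ver_tgt i : i <= size r ->
  (ver (rev (take i r))).1 = nth u (u :: P) i /\
  (forall c0, i < size r -> (ver (rev (take i r))).2 (nth c0 r i) = nth u P i) /\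
  (forall c p, rev (take i r) = c :: p -> (ver (c :: p)).2 c = (ver p).1).
Proof.
elim: i => [|i IH] ir.
  rewrite take0 /=; split=> //; split=> // c0 r0.
  have := (nEP (u, tgt [::])).2; have := tgtE c0 r0; rewrite take0 /= => ->.
  apply; rewrite ?inE //= andbT.
  by apply: (enodes (i := 0)); rewrite -rPsz.
have [IH1 [IH2 _]] := IH (ltnW ir).
have c0 : 'I_d by case: (r) ir.
rewrite (rev_take_step c0 ir).
have E1 : (ver (nth c0 r i :: rev (take i r))).1 = nth u (u :: P) i.+1.
  by rewrite /= IH2.
have back c p : nth c0 r i :: rev (take i r) = c :: p -> e (ver (c :: p)).1 (ver p).1.
  by move=> _; rewrite esym ver_adj.
split=> //.
have [ir2|ir2] := boolP (i.+1 < size r); last first.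
  split=> // c p [<- <-] /=.
  have -> : tgt (nth c0 r i :: rev (take i r)) = [::].
    rewrite -(rev_take_step c0 ir) /tgt size_rev size_takel // drop_oversize.
      by case: ifP.
    by rewrite leqNgt.
  apply: (nEP (_, _)).2 => //=; last by rewrite inE.
  by rewrite andbT esym; apply: ver_adj.
have H : forall c y, (c, y) \in (nth c0 r i, (ver (rev (take i r))).1) ::
      tgt (nth c0 r i :: rev (take i r)) ->
   (ver (nth c0 r i :: rev (take i r))).2 c = y.
  apply: (nEP (_, _)).2 => /=.
  - rewrite -(rev_take_step c0 ir) (tgtE c0 ir2) /= andbT inE.
    exact: rnth.
  - rewrite -(rev_take_step c0 ir) (tgtE c0 ir2) /= andbT inE IH1.
    change (nth u P i.+1) with (nth u (u :: P) i.+2).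
    rewrite nth_uniq //=; rewrite -?rPsz; lia.
  - apply/andP; split; first by rewrite esym; apply: (ver_adj).
    rewrite -(rev_take_step c0 ir) (tgtE c0 ir2) /= andbT.
    rewrite IH2 //; apply: (@enodes i.+1); by rewrite -rPsz.
split.
  move=> c1 _; rewrite (set_nth_default c0) //; apply: H.
  by rewrite -(rev_take_step c0 ir) (tgtE c0 ir2) !inE eqxx orbT.
by move=> c p [<- <-]; apply: H; rewrite inE eqxx.
Qed.

Let ver_parent c p : (ver (c :: p)).2 c = (ver p).1.
Proof.
have [sp|sp] := boolP (rev (c :: p) == take (size (c :: p)) r).
  have [ss|ss] := leqP (size (c :: p)) (size r).
    have [_ [_]] := ver_tgt ss; apply.
    by rewrite -(eqP sp) revK.
  have /(congr1 size) := eqP sp.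
  by rewrite size_rev (take_oversize (ltnW ss)) => se; rewrite se ltnn in ss.
have tE : tgt (c :: p) = [::] by rewrite /tgt (negbTE sp).
change (nE ((ver p).2 c, (c, (ver p).1) :: tgt (c :: p)) c = (ver p).1).
rewrite tE; apply: (nEP (_, _)).2 => //=; last by rewrite inE.
by rewrite andbT esym; apply: ver_adj.
Qed.

Fixpoint upt p := if p is c :: p' then (ver p').1 :: upt p' else [::].
(** The way back from the vertex of p to the root. *)
Definition up p := (ver p).1 :: upt p.

Let upt_path p : path e (ver p).1 (upt p).
Proof. by elim: p => //= c p ->; rewrite andbT esym ver_adj. Qed.

Let upt_last p : last (ver p).1 (upt p) = u.
Proof. by elim: p. Qed.

(** A first return would close a cycle, unless it backtracks at once, which the
    way along a reduced word never does. *)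
Let up_uniq p : reduced p -> uniq (up p).
Proof.
elim: p => [//|c p IH] rp; have up_p := IH (path_sorted rp).
rewrite /up cons_uniq; apply/andP; split; last exact: up_p.
have e1 := ver_adj c p; have pp := upt_path p.
apply/negP; rewrite inE => /orP[/eqP xy|xin].
  by move: e1; rewrite xy eirr.
set x := (ver (c :: p)).1 in e1 xin.
have [p1 [p2 eP]] := mem_split xin.
clear xin; case: p1 eP => [|a p1] eP.
  case: p rp {IH} up_p pp @x e1 eP => [//|c' p'] rp up_p pp x e1 [eP _].
  have cc : c' = c.
    by apply: (verE (c' :: p')).1; rewrite ver_parent.
  by move: rp; rewrite /reduced /= cc eqxx.
have {}eP : upt p = (a :: p1) ++ x :: p2 by exact: eP.
have : size (x :: (ver p).1 :: a :: p1) < 3.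
  apply: acyc; rewrite /ucycle [cycle _ _]/= esym e1 /=.
  move: pp up_p; rewrite /up eP /= cat_path rcons_path /=.
  rewrite !inE !mem_cat !inE !negb_or cat_uniq /=.
  move=> /and4P[-> -> -> _] /and5P[/and4P[-> -> n3 _] /and3P[-> n5 _] ->].
  by move=> /norP[-> _] _; rewrite eq_sym n3 eq_sym n5.
by [].
Qed.

Let up_inj p q : up p = up q -> p = q.
Proof.
elim: p q => [|c p IH] [|c' q] //; rewrite /up => -[] // Ev Ew Eu.
have pq : p = q by apply: IH; rewrite /up Ew Eu.
by subst q; congr cons; apply: (verE p).1.
Qed.

Let ver_inj p q : reduced p -> reduced q -> (ver p).1 = (ver q).1 -> p = q.
Proof.
move=> rp rq E; apply: up_inj; rewrite /up E; congr cons.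
have pp := upt_path p; have up_p := up_uniq rp; have lp := upt_last p.
rewrite /up E in pp up_p lp.
apply: (uniq_path_unique acyc esym pp (upt_path q) up_p (up_uniq rq)).
by rewrite lp upt_last.
Qed.

Let ver_surj_path p : path e u p -> uniq (u :: p) ->
  exists w, reduced w /\ up w = rev (u :: p).
Proof.
elim/last_ind: p => [|p z IH]; first by exists [::].
rewrite rcons_path -rcons_cons rcons_uniq => /andP[pp ez] /andP[zN up_].
have [w [rw Ew]] := IH pp up_.
have vw : (ver w).1 = last u p.
  by move: Ew; rewrite lastI rev_rcons => -[].
have [c zE] : exists c, z = (ver w).2 c by apply/(verE w).2; rewrite vw.
exists (c :: w); split; last by rewrite rev_rcons -Ew zE.
case: w rw Ew vw zE => [//|c' w'] rw Ew vw zE.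
rewrite /reduced /= -/(reduced (c' :: w')).
suff -> : c != c' by exact: rw.
apply: contraNneq zN => cc'; subst c'.
rewrite -mem_rev -Ew /up zE ver_parent.
by rewrite inE /= inE eqxx orbT.
Qed.

Let ver_surj z : exists w, reduced w /\ (ver w).1 = z.
Proof.
have [p [pp lp _ up_]] := gdist_uniq_path u z.
have [w [rw E]] := ver_surj_path pp up_.
exists w; split=> //; move: E; rewrite lastI rev_rcons => -[->].
by rewrite -lp; case: (p) => //.
Qed.

Lemma coloring_of_enumeration : exists word nb,
  coloring e u word nb /\ word v = w0.
Proof.
have [word wordP] := choice ver_surj.
have wv p : reduced p -> word (ver p).1 = p.
  by move=> rp; apply: ver_inj => //; case: (wordP (ver p).1).
exists word, (fun c x => (ver (lmul c (word x))).1); split; last first.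
  have [] := @ver_tgt (size r) (leqnn _).
  rewrite take_size revK rPsz nth_last /= Pv => <- _.
  exact: wv.
split.
- by move=> x y E; rewrite -(wordP x).2 E (wordP y).2.
- by move=> c x; rewrite wv //; apply: lmul_reduced; case: (wordP x).
- by move=> x; case: (wordP x).
- exact: (wv [::]).
move=> x y; have [rx vx] := wordP x; split.
  rewrite -{1}vx => exy; have [c yE] := ((verE (word x)).2 y).1 exy.
  exists c; rewrite yE {yE exy}.
  case: (word x) => [//|c' w'] /=.
  by have [->|//] := eqVneq c c'; apply: ver_parent.
move=> [c ->]; rewrite -{1}vx.
case: (word x) => [|c' w']; first exact: ver_adj.
rewrite /lmul; have [_|_] := eqVneq c c'; last exact: ver_adj.
by rewrite esym; apply: ver_adj.
Qed.

End Root.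

(** Since the word of v is arbitrary, any two pairs of vertices at the same
    distance have the same position with respect to suitable colorings. *)
Lemma tree_coloring u v w : reduced w -> gdist e u v = size w ->
  exists (word : V -> seq 'I_d) (nb : 'I_d -> V -> V), coloring e u word nb /\ word v = w.
Proof.
move=> rw guv; have [P [pP lP sP uP]] := gdist_uniq_path u v.
have [nE nEP] : {nE & forall xc, adjusted xc (nE xc)}.
  by apply: (@choice _ _ adjusted) => -[x cs]; apply: enumerates_adjust.
by apply: (coloring_of_enumeration rw pP lP _ uP nEP); rewrite sP.
Qed.

End TreeColoring.

(** * Coverings by the tree, and graphs of large girth *)

(** The covering map of a graph by the tree that sends the root to y, when the
    neighbors of a vertex of the graph are given by the letters. *)
Definition cover (V : choiceType) (d : nat) (S : Type) (word : V -> seq 'I_d)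
  (s : 'I_d -> S -> S) (y : S) (x : V) : S := act s (word x) y.

Section Covers.
Variables (V : choiceType) (e : rel V) (d : nat) (u : V).
Variables (word : V -> seq 'I_d) (nb : 'I_d -> V -> V).
Hypothesis col : coloring e u word nb.

Lemma word_inj : injective word. Proof. by case: col. Qed.
Lemma word_nb c x : word (nb c x) = lmul c (word x). Proof. by case: col. Qed.
Lemma word_red x : reduced (word x). Proof. by case: col. Qed.
Lemma word_root : word u = [::]. Proof. by case: col. Qed.
Lemma nb_edge x y : e x y <-> exists c, y = nb c x.
Proof. by case: col. Qed.

Lemma nbK c : involutive (nb c).
Proof. by move=> x; apply: word_inj; rewrite !word_nb lmulK // word_red. Qed.

Lemma word_act w x : word (act nb w x) = act lmul w (word x).
Proof. by elim: w => //= c w IH; rewrite word_nb IH. Qed.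

Lemma act_word x : act nb (word x) u = x.
Proof. by apply: word_inj; rewrite word_act word_root act_lmul_nil // word_red. Qed.

Lemma walk_act w x : walk e x (act nb w x) (size w).
Proof.
elim: w => [|c w [p [pp lp sp]]] /=; first by exists [::].
exists (rcons p (nb c (act nb w x))).
rewrite rcons_path last_rcons size_rcons sp pp /= lp; split=> //.
by apply/nb_edge; exists c.
Qed.

Lemma act_of_walk x y n : walk e x y n -> exists w, size w = n /\ y = act nb w x.
Proof.
move=> [p]; elim/last_ind: p y n => [|p z IH] y n [pp lp sp].
  by exists [::].
move: pp; rewrite rcons_path => /andP[pp ez].
have [w [sw Ew]] := IH (last x p) (size p) (And3 pp erefl erefl).
have [c zE] := (nb_edge _ _).1 ez.
exists (c :: w); rewrite /= sw -Ew -zE; split; first by rewrite -sp size_rcons.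
by rewrite -lp last_rcons.
Qed.

Section OneCover.
Variables (S : Type) (s : 'I_d -> S -> S).
Hypothesis sK : forall c, involutive (s c).
Variable y : S.
Local Notation cov := (cover word s y).

Lemma cover_nb c x : cov (nb c x) = s c (cov x).
Proof. by rewrite /cover word_nb act_lmul. Qed.

Lemma cover_act w x : cov (act nb w x) = act s w (cov x).
Proof. by elim: w => //= c w IH; rewrite cover_nb IH. Qed.

Lemma cover_root : cov u = y.
Proof. by rewrite /cover word_root. Qed.

End OneCover.
End Covers.

(** Following the words of one coloring in the other one gives an automorphism.
    Through it a symmetric potential descends to all graphs covered by the
    tree. *)
Lemma deck (V : choiceType) (e : rel V) (d : nat) (u u' : V)
    (word word' : V -> seq 'I_d) (nb nb' : 'I_d -> V -> V)
    (col : coloring e u word nb) (col' : coloring e u' word' nb') (x : V) :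
  exists g ginv, [/\ automorphism e g ginv, g u' = x &
    forall (S : Type) (s : 'I_d -> S -> S) (sK : forall c, involutive (s c)) y z,
      cover word s y (g z) = cover word' s (cover word s y x) z].
Proof.
have nK := nbK col; have nK' := nbK col'.
set h := cover word nb' (act nb' (rev (word x)) u').
set g := cover word' nb x.
have hx : h x = u' by rewrite /h /cover -{1}(revK (word x)) act_revK.
have hg : cancel g h.
  by move=> z; rewrite /h (cover_act col nK') -/h hx (act_word col').
have gh : cancel h g.
  move=> z; rewrite /h {1}/cover /g !(cover_act col' nK) (cover_root col').
  rewrite -{2}(act_word col x) act_revK //; exact: (act_word col).
exists g, h; split; last 1 first.
- by move=> S s sK y z; rewrite -[g z]/(act nb (word' z) x) (cover_act col sK).
- split=> // a b; apply/idP/idP.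
    move=> /(nb_edge col)[c E]; apply/(nb_edge col'); exists c.
    by apply: (can_inj hg); rewrite E /g (cover_nb col' nK).
  move=> /(nb_edge col')[c ->]; apply/(nb_edge col); exists c.
  by rewrite /g (cover_nb col' nK).
- exact: (cover_root col').
Qed.

Section Distance.
Variables (V : choiceType) (e : rel V) (d : nat).
Hypothesis hT : regular_tree e d.
Variables (u : V) (word : V -> seq 'I_d) (nb : 'I_d -> V -> V).
Hypothesis col : coloring e u word nb.

Lemma gdist_act x y : exists w, size w = gdist e x y /\ y = act nb w x.
Proof. exact: (act_of_walk col (gdist_walk hT x y)). Qed.

Lemma gdist_act_le w x : gdist e x (act nb w x) <= size w.
Proof. exact: gdist_le (walk_act col w x). Qed.

Lemma gdist_sym x y : gdist e x y = gdist e y x.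
Proof.
suff H a b : gdist e a b <= gdist e b a by apply/eqP; rewrite eqn_leq !H.
have [w [<- ->]] := gdist_act b a.
have := gdist_act_le (rev w) (act nb w b).
by rewrite (act_revK (nbK col)) size_rev.
Qed.

Lemma gdist_triangle x y z : gdist e x z <= gdist e x y + gdist e y z.
Proof.
have [w [<- ->]] := gdist_act x y; have [w' [<- ->]] := gdist_act (act nb w x) z.
by rewrite -act_cat addnC -size_cat gdist_act_le.
Qed.

Lemma gdist0 x y : gdist e x y = 0 -> x = y.
Proof. by move=> xy; have [w []] := gdist_act x y; rewrite xy => /size0nil ->. Qed.

Lemma gdistxx x : gdist e x x = 0.
Proof. by apply/eqP; rewrite -leqn0; exact: (gdist_act_le [::]). Qed.

Lemma finite_ball x n : finite_set (ball_in e x n).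
Proof.
apply: (@sub_finite_set _ _ ((fun w : n.-bseq 'I_d => act nb w x) @` setT)).
  move=> y /=; rewrite /ball_in /= => xy.
  have [w [sw ->]] := gdist_act x y.
  by rewrite -sw in xy; exists (Bseq xy).
exact: finite_image.
Qed.

Lemma finite_boundary r (L : set V) : finite_set L -> finite_set (boundary e r L).
Proof.
move=> fL; apply: (@sub_finite_set _ _ (\bigcup_(x in L) ball_in e x r)).
  by move=> y [_ [x Lx xy]]; exists x.
by apply: bigcup_finite => // x _; apply: finite_ball.
Qed.

(** Closed walks of length at most L come from closed walks in the tree. *)
Definition large_girth (S : Type) (s : 'I_d -> S -> S) L :=
  forall w y, size w <= L -> act s w y = y -> act lmul w [::] = [::].

(** Two vertices of the ball with the same image give a closed walk of length at
    most 2 M. *)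
Lemma cover_inj (S : Type) (s : 'I_d -> S -> S) (sK : forall c, involutive (s c))
    M (gs : large_girth s M.*2) (y : S) (x0 x x' : V) :
  ball_in e x0 M x -> ball_in e x0 M x' ->
  cover word s y x = cover word s y x' -> x = x'.
Proof.
rewrite /ball_in /= => x0x x0x'.
have : gdist e x x' <= M.*2.
  apply: (leq_trans (gdist_triangle x x0 x')).
  by rewrite (gdist_sym x x0) -addnn leq_add.
have [w [<- ->]] := gdist_act x x' => sw.
rewrite (cover_act col sK) => E.
have Ew := gs w _ sw (esym E).
by rewrite -{1}[x]/(act nb [::] x) -Ew (act_act (nbK col)).
Qed.

End Distance.

(** A Cayley graph of large girth. Letters act on the words of length at most L by
    left multiplication, truncated so as to remain involutive, and thereby on the
    permutations of these words. A short word with a fixed permutation acts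
    trivially on the words, but sends the empty word to its own reduction. *)
Section Girth.
Variables (d L : nat).
Local Notation W := (L.-bseq 'I_d).

Definition tmul (c : 'I_d) (w : W) : W :=
  if reduced w then insubd w (lmul c w) else w.

Lemma tmulK c : involutive (tmul c).
Proof.
move=> w; rewrite {2}/tmul; case: ifP => rw; last by rewrite /tmul rw.
rewrite /tmul; apply/val_inj; have := val_insubd w (lmul c w).
case: (leqP (size (lmul c w)) L) => sl E.
  by rewrite E lmul_reduced // val_insubd /= E lmulK // (valP w).
by rewrite E rw val_insubd E leqNgt sl.
Qed.

Definition pmul (c : 'I_d) (q : {perm W}) : {perm W} :=
  (q * perm (can_inj (tmulK c)))%g.

Lemma pmulK c : involutive (pmul c).
Proof.
move=> q; apply/perm.permP => x; rewrite /pmul !permM !permE; exact: tmulK.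
Qed.

Lemma act_pmul w q x : act pmul w q x = act tmul w (q x).
Proof. by elim: w => //= c w IH; rewrite /pmul permM permE IH. Qed.

Lemma act_tmul w (b : W) : size w <= L -> b = [::] :> seq _ ->
  act tmul w b = act lmul w [::] :> seq _.
Proof.
move=> + b0; elim: w => [_|c w IH sw]; first by rewrite /= b0.
have {}IH := IH (ltnW sw); rewrite /= /tmul; move: (act tmul w b) IH => z Ez.
rewrite Ez act_reduced // val_insubd.
by rewrite ifT // -[lmul c _]/(act lmul (c :: w) [::]) (leq_trans (size_act_lmul _ _)) // addn0.
Qed.

Lemma pmul_girth : large_girth pmul L.
Proof.
move=> w q sw E; pose b : W := [bseq].
have := congr1 (fun p : {perm W} => p ((q^-1)%g b)) E.
by rewrite /= act_pmul permKV => /(congr1 val) /=; rewrite act_tmul.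
Qed.

End Girth.

Lemma large_girth_le d (S : Type) (s : 'I_d -> S -> S) L L' :
  L <= L' -> large_girth s L' -> large_girth s L.
Proof. by move=> LL gs w y sw; apply: gs; apply: leq_trans LL. Qed.

Lemma large_girth_equivariant (d L : nat) (S Q : Type) (s : 'I_d -> S -> S)
    (t : 'I_d -> Q -> Q) (f : S -> Q) :
  (forall c x, f (s c x) = t c (f x)) -> large_girth t L -> large_girth s L.
Proof.
move=> fs gt w y sw E; apply: (gt w (f y) sw); rewrite -{2}E.
by elim: (w) => //= c w' ->.
Qed.

(** * Extending a finitely additive probability to the Borel sets *)

Local Open Scope ring_scope.

(** All subsets get a probability, so that pointwise limits stay in this class
    without any question of measurability. *)
Definition fa_prob (R : realType) (T : Type) (m : set T -> R) : Prop :=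
  [/\ m setT = 1, forall E, 0 <= m E &
      forall E F, E `&` F = set0 -> m (E `|` F) = m E + m F].

Section FiniteAdditive.
Variables (R : realType) (T : Type) (m : set T -> R).
Hypothesis fm : fa_prob m.

Lemma fa_ge0 E : 0 <= m E. Proof. by case: fm. Qed.
Lemma fa_setT : m setT = 1. Proof. by case: fm. Qed.
Lemma fa_setU E F : E `&` F = set0 -> m (E `|` F) = m E + m F.
Proof. by case: fm => _ _; apply. Qed.

Lemma fa_set0 : m set0 = 0.
Proof. by have := @fa_setU set0 set0 (setI0 _); rewrite setU0 -{1}[m set0]addr0 => /addrI. Qed.

Lemma fa_le E F : E `<=` F -> m E <= m F.
Proof.
move=> EF; rewrite -(setDUK EF) fa_setU ?lerDl ?fa_ge0 //.
exact: setDIK.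
Qed.

Lemma fa_le1 E : m E <= 1.
Proof. by rewrite -fa_setT; apply: fa_le. Qed.

Lemma fa_partition (I : finType) (f : T -> I) E :
  m E = \sum_i m (E `&` f @^-1` [set i]).
Proof.
have H (s : seq I) : uniq s -> m (E `&` [set x | f x \in s]) =
    \sum_(i <- s) m (E `&` f @^-1` [set i]).
  elim: s => [_|i s IH /= /andP[is_ us]].
    rewrite big_nil (_ : _ `&` _ = set0) ?fa_set0 //.
    by rewrite -subset0 => x [].
  rewrite big_cons -IH // -fa_setU.
    congr m; apply/seteqP; split=> x /=.
      by move=> [Ex]; rewrite inE => /orP[/eqP fi|fs]; [left|right].
    by move=> [[Ex /= ->]|[Ex fs]]; split=> //; rewrite inE ?eqxx // fs orbT.
  rewrite -subset0 => x /= [[_ fxi] [_]].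
  by rewrite /= in fxi; rewrite fxi => ii; rewrite ii in is_.
have := H (index_enum I) (index_enum_uniq I); rewrite -H ?index_enum_uniq //.
move=> _; congr m; apply/seteqP; split=> [x Ex|x []//]; split=> //=.
by rewrite mem_index_enum.
Qed.

End FiniteAdditive.

Section Kolmogorov.
Variables (R : realType) (A : pointedFinType).

(** In reverse order, so that longer prefixes are obtained by [cons]. *)
Fixpoint prefix (om : nat -> A) n : seq A :=
  if n is n'.+1 then om n' :: prefix om n' else [::].

Lemma size_prefix om n : size (prefix om n) = n.
Proof. by elim: n => //= n ->. Qed.

Lemma prefix_eq om om' n : prefix om n = prefix om' n ->
  forall i, (i < n)%N -> om i = om' i.
Proof.
elim: n => // n IH /= [E /IH H] i; rewrite ltnS leq_eqVlt => /orP[/eqP -> //|].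
exact: H.
Qed.

Variable m : set (nat -> A) -> R.
Hypothesis fm : fa_prob m.

(** The unit interval is cut into consecutive intervals whose lengths are the
    masses of the values of the first coordinate; each of them is cut in the same
    way according to the second coordinate, and so on. The labels of the intervals
    around a uniform point form a sequence with the prescribed finite-dimensional
    laws. *)
Definition mass (b : seq A) : R := m [set om | prefix om (size b) = b].

Lemma mass_ge0 b : 0 <= mass b. Proof. exact: fa_ge0. Qed.

Lemma mass_nil : mass [::] = 1.
Proof.
by rewrite /mass -(fa_setT fm); congr m; apply/seteqP; split.
Qed.

Lemma mass_cons b : mass b = \sum_c mass (c :: b).
Proof.
rewrite /mass (fa_partition fm (fun om => om (size b))).
apply: eq_bigr => c _; congr m; apply/seteqP; split=> om /=.
  by move=> [-> ->].
by move=> [-> ->].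
Qed.

Local Notation rk := (@enum_rank A).

Definition below (c : A) (b : seq A) : R :=
  \sum_(c' | (rk c' < rk c)%N) mass (c' :: b).

Fixpoint left_end (b : seq A) : R :=
  if b is c :: b' then left_end b' + below c b' else 0.

Definition interval_of (b : seq A) : set R :=
  `[left_end b, left_end b + mass b[%classic.

Lemma below_step c b : below c b + mass (c :: b) =
  \sum_(c' | (rk c' <= rk c)%N) mass (c' :: b).
Proof.
rewrite [RHS](bigD1 c) //= addrC; congr (_ + _); apply: eq_bigl => c'.
by rewrite ltn_neqAle andbC (inj_eq val_inj) (inj_eq enum_rank_inj).
Qed.

Lemma below_mono c c' b : (rk c < rk c')%N ->
  below c b + mass (c :: b) <= below c' b.
Proof.
move=> cc'; rewrite below_step /below.
rewrite [leLHS]big_mkcond [leRHS]big_mkcond; apply: ler_sum => x _.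
case: ifP => [xc|_]; first by rewrite (leq_ltn_trans xc cc').
by case: ifP => // _; apply: mass_ge0.
Qed.

Lemma interval_sub c b : interval_of (c :: b) `<=` interval_of b.
Proof.
move=> x; rewrite /interval_of /= !in_itv /= => /andP[l h].
apply/andP; split.
  apply: le_trans l; rewrite lerDl sumr_ge0 // => *; exact: mass_ge0.
apply: (lt_le_trans h); rewrite -addrA lerD2l below_step (mass_cons b).
rewrite [leLHS]big_mkcond; apply: ler_sum => x' _.
by case: ifP => // _; apply: mass_ge0.
Qed.

Lemma interval_uniq c c' b x :
  interval_of (c :: b) x -> interval_of (c' :: b) x -> c = c'.
Proof.
wlog cc' : c c' / (rk c <= rk c')%N.
  move=> H; case: (leqP (rk c) (rk c')) => [/H//|/ltnW cc' h1 h2].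
  by apply/esym/H.
rewrite leq_eqVlt in cc'; case/orP: cc' => [/eqP/val_inj/enum_rank_inj//|cc'].
rewrite /interval_of /= !in_itv /= => /andP[_ h] /andP[l _].
have := lt_le_trans h (le_trans _ l).
by rewrite -addrA lerD2l below_mono // ltxx => /(_ isT).
Qed.

Lemma interval_ex b x : interval_of b x -> exists c, interval_of (c :: b) x.
Proof.
rewrite /interval_of /= in_itv /= => /andP[l h].
pose S j := \sum_(c' : A | (rk c' < j)%N) mass (c' :: b).
have ex : exists j, x < left_end b + S j.
  exists #|A|; apply: (lt_le_trans h); rewrite lerD2l mass_cons /S.
  rewrite le_eqVlt; apply/orP; left; apply/eqP.
  by apply: eq_bigl => c; rewrite ltn_ord.
case: (ex_minnP ex) => -[|j] xj minj.
  by move: xj; rewrite /S big_pred0 // addr0 => /lt_geF; rewrite l.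
have jA : (j < #|A|)%N.
  rewrite ltnNge; apply/negP => Aj.
  suff : (j < j)%N by rewrite ltnn.
  apply: minj; congr (_ < _) : xj; congr (_ + _); apply: eq_bigl => c.
  by rewrite !(leq_trans (ltn_ord _)) // ltnW.
pose c := enum_val (Ordinal jA); have rc : rk c = j :> nat by rewrite enum_valK.
exists c; rewrite /= in_itv /=; apply/andP; split.
  rewrite leNgt; apply/negP => xlt.
  suff : (j < j)%N by rewrite ltnn.
  by apply: minj; apply: (lt_le_trans xlt); rewrite /below rc.
by rewrite -addrA below_step rc; exact: xj.
Qed.

Fixpoint digits (x : R) n : seq A :=
  if n is n'.+1 then
    xget point [set c | interval_of (c :: digits x n') x] :: digits x n'
  else [::].

Lemma digits_interval x n : interval_of [::] x -> interval_of (digits x n) x.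
Proof.
move=> x01; elim: n => //= n IH.
by have [c xc] := interval_ex IH; case: xgetP => [c' -> //|/(_ c)].
Qed.

Lemma interval_digits x b : interval_of b x -> b = digits x (size b).
Proof.
elim: b => //= c b IH xcb; have E := IH (interval_sub xcb); rewrite -E.
by congr cons; case: xgetP => [c' _|/(_ c)//]; apply: interval_uniq.
Qed.

Lemma size_digits x n : size (digits x n) = n.
Proof. by elim: n => //= n ->. Qed.

Lemma digits_preimage b :
  [set x | interval_of [::] x /\ digits x (size b) = b] = interval_of b.
Proof.
apply/seteqP; split=> x /=; first by move=> [/(@digits_interval _ (size b)) + E]; rewrite E.
move=> xb; split; last by rewrite -interval_digits.
by elim: b xb => // c b IH /interval_sub/IH.
Qed.

End Kolmogorov.

Definition cylinder (V A : Type) (E : set (V -> A)) : Prop :=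
  exists xs : seq V, forall om om' : V -> A,
    (forall x, List.In x xs -> om x = om' x) -> E om -> E om'.

Section Topology.
Variables (V : choiceType) (A : pointedFinType).
Local Notation PT := (prod_topology (fun _ : V => discrete_topology A)).

Lemma nbhs_coordinate (om : PT) (v : V) :
  nbhs om [set om' : PT | om' v = om v].
Proof.
have /(_ om) := @proj_continuous V (fun _ => discrete_topology A) v.
move=> /(_ [set om v]); apply.
by rewrite /= nbhs_principalE.
Qed.

Lemma cylinder_open (E : set PT) : cylinder E -> open E.
Proof.
move=> [xs H]; rewrite openE => om Eom.
have N : nbhs om [set om' : PT | forall x, List.In x xs -> om x = om' x].
  elim: xs {H} => [|x xs IH]; first by apply: filterS filterT => ? _ ? [].
  apply: filterS (filterI IH (nbhs_coordinate om x)) => om' [/= h1 h2] y.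
  by move=> [<-//|]; apply: h1.
by apply: filterS N => om' /= h; apply: H Eom.
Qed.

(** The configurations that agree with om on finitely many vertices form a filter
    base converging to om. *)
Lemma open_depends_finite (idx : V -> nat) (U : set PT) (om : PT) :
  open U -> U om ->
  exists n, forall om' : PT, (forall v, (idx v < n)%N -> om' v = om v) -> U om'.
Proof.
move=> oU Uom.
pose C n : set PT := [set om' | forall v, (idx v < n)%N -> om' v = om v].
pose F := filter_from setT C.
have FF : Filter F.
  apply: filter_from_filter; first by exists 0%N.
  move=> i j _ _; exists (maxn i j) => // om' h; split=> v vi; apply: h.
    by rewrite (leq_trans vi) // leq_maxl.
  by rewrite (leq_trans vi) // leq_maxr.
have cF : F --> om.
  apply/cvg_sup => v W [W'] [[W''] oW'' <-] W''om W'W.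
  apply: (filterS W'W); exists (idx v).+1 => // om' /(_ v (leqnn _)) E.
  by rewrite /= E.
have : nbhs om U by apply: open_nbhs_nbhs.
by move=> /cF [n _ h]; exists n => om' h'; apply: h.
Qed.

End Topology.

Lemma cylinder_measurable (V : choiceType) (A : pointedFinType)
  (E : set (borel_config V A)) : cylinder E -> measurable E.
Proof. by move=> /cylinder_open oE; apply: sub_gen_smallest. Qed.

Lemma fsbig_finType (T : Type) (idx : T) (op : Monoid.com_law idx) (I : finType)
    (F : I -> T) :
  \big[op/idx]_(i \in [set: I]) F i = \big[op/idx]_i F i.
Proof.
rewrite fsbig_finite; last exact: finite_finset.
apply: perm_big; apply: uniq_perm; rewrite ?index_enum_uniq ?finmap.fset_uniq //.
move=> i; rewrite mem_index_enum in_fset_set; [exact: mem_set|exact: finite_finset].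
Qed.

Section Extension.
Variables (R : realType) (V : choiceType) (A : pointedFinType) (idx : V -> nat).
Hypothesis idx_inj : injective idx.
Variable m : set (V -> A) -> R.
Hypothesis fm : fa_prob m.

Definition lift_seq (om : V -> A) : nat -> A := fun n =>
  if pselect (exists v, idx v = n) is left h then om (projT1 (cid h)) else point.

Lemma lift_seqE om v : lift_seq om (idx v) = om v.
Proof.
rewrite /lift_seq; case: pselect => [h|[]]; last by exists v.
by case: cid => v' /= /idx_inj ->.
Qed.

Definition pushm : set (nat -> A) -> R := fun E => m (lift_seq @^-1` E).

Lemma fa_pushm : fa_prob pushm.
Proof.
split; first exact: (fa_setT fm).
  by move=> E; apply: (fa_ge0 fm).
move=> E F EF; rewrite /pushm preimage_setU (fa_setU fm) //.
by rewrite -preimage_setI EF preimage_set0.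
Qed.

Let P : probability (measurableTypeR R) R := uniform_prob (@ltr01 R).

Definition digit_event (b : seq A) : set (measurableTypeR R) := [set x | digits pushm x (size b) = b].

Lemma interval_of_nil : interval_of pushm [::] = `[0, 1[%classic.
Proof. by rewrite /interval_of /= (mass_nil fa_pushm) add0r. Qed.

Lemma interval_of_sub01 b : interval_of pushm b `<=` `[0, 1[%classic.
Proof.
rewrite -interval_of_nil; elim: b => // c b IH.
by move=> x /(interval_sub fa_pushm)/IH.
Qed.

Lemma measurable_digit_event b : measurable (digit_event b).
Proof.
have -> : digit_event b = interval_of pushm b `|` (digit_event b `\` `[0, 1[%classic).
  rewrite -(digits_preimage fa_pushm) interval_of_nil; apply/seteqP; split=> x /=.
    by have [x01|x01] := pselect (x \in `[0, 1[) => E; [left|right].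
  by move=> [[]|[]].
apply: measurableU; first exact: measurable_itv.
have junk x : ~ (`[0, 1[%classic x) -> digits pushm x (size b) = nseq (size b) point.
  move=> x01; elim: (size b) => //= n ->; congr cons; case: xgetP => // c _ h.
  by exfalso; apply: x01; apply: interval_of_sub01 h.
have [bE|bE] := eqVneq b (nseq (size b) point).
  have -> : digit_event b `\` `[0, 1[%classic = ~` `[0, 1[%classic.
    apply/seteqP; split=> x /=; first by case.
    by move=> x01; split=> //; rewrite /digit_event /= junk.
  by apply: measurableC; apply: measurable_itv.
rewrite (_ : _ `\` _ = set0); first exact: measurable0.
rewrite -subset0 => x [] /= E /junk E'.
by move: bE; rewrite -E' E eqxx.
Qed.

Lemma uniform_itv01 (a b : R) : 0 <= a -> a <= b -> b <= 1 ->
  P `[a, b[%classic = (b - a)%:E.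
Proof.
move=> a0 ab b1; rewrite [LHS]integral_uniform_pdf.
have -> : `[a, b[%classic `&` `[0, 1]%classic = `[a, b[%classic :> set R.
  apply/seteqP; split=> x /=; first by case.
  rewrite !in_itv /= => /andP[ax xb]; rewrite ax xb; split=> //.
  by rewrite (le_trans a0 ax) (ltW (lt_le_trans xb b1)).
rewrite (eq_integral (fun=> 1%:E)); last first.
  move=> x; rewrite inE /= in_itv /= => /andP[ax xb].
  by rewrite /uniform_pdf (le_trans a0 ax) (ltW (lt_le_trans xb b1)) subr0 invr1.
rewrite integral_cst //= mul1e lebesgue_measure_itv /= lte_fin.
case: ifP => [_|/negbT]; first by rewrite EFinB.
by rewrite -leNgt => ba; have -> : a = b by [apply/le_anti; rewrite ab ba]; rewrite subrr.
Qed.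

Lemma digit_event_prob b : P (digit_event b) = (mass pushm b)%:E.
Proof.
have I01 : P `[0, 1[%classic = 1%E by rewrite uniform_itv01 ?subr0 ?ler01.
have mD := measurable_digit_event b.
have mI : measurable (`[0, 1[%classic : set R) by apply: measurable_itv.
have -> : P (digit_event b) = P (digit_event b `&` `[0, 1[%classic).
  rewrite (measureDI P mD mI) -[RHS]add0e; congr (_ + _)%E.
  apply/eqP; rewrite eq_le measure_ge0 andbT.
  apply: (@le_trans _ _ (P (~` `[0, 1[%classic))).
    apply: le_measure; rewrite ?inE; [exact: measurableD|exact: measurableC|].
    by move=> x [].
  by rewrite (probability_setC P mI) I01 subee.
have -> : digit_event b `&` `[0, 1[%classic = interval_of pushm b.
  by rewrite -(digits_preimage fa_pushm) interval_of_nil setIC.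
have sub := @interval_of_sub01 b; move: sub (mass_ge0 fa_pushm b).
rewrite /interval_of => sub; rewrite le_eqVlt => /orP[/eqP M0|M0].
  rewrite -M0 addr0 (_ : `[_, _[%classic = set0) ?measure0 //.
  by rewrite -subset0 => x; rewrite /= in_itv /= => /andP[/le_lt_trans h /h]; rewrite ltxx.
rewrite uniform_itv01 ?lerDl ?(ltW M0) //; first by rewrite addrC addKr.
  have := sub (left_end pushm b); rewrite /= !in_itv /= lexx ltrDl M0.
  by move=> /(_ isT) /andP[].
rewrite leNgt; apply/negP => lt1.
have := sub (Num.max (left_end pushm b) 1); rewrite /= !in_itv /= le_max lexx /=.
rewrite gt_max lt1 ltrDl M0 => /(_ isT) /andP[_].
by rewrite gt_max ltxx andbF.
Qed.

Definition sample (x : R) (n : nat) : A := head point (digits pushm x n.+1).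

Lemma prefix_sample x n : prefix (sample x) n = digits pushm x n.
Proof. by elim: n => //= n ->. Qed.

Definition sample_config (x : measurableTypeR R) : borel_config V A := fun v => sample x (idx v).

Lemma measurable_sample_config : measurable_fun setT sample_config.
Proof.
pose G : set (set (V -> A)) := @open (prod_topology (fun _ : V => discrete_topology A)).
apply: (@measurability _ _ (measurableTypeR R) (borel_config V A) setT sample_config G) => //.
move=> _ [U oU <-]; rewrite setTI.
pose good (b : seq A) := forall s : nat -> A, prefix s (size b) = b ->
  U (fun v => s (idx v)).
have -> : sample_config @^-1` U =
    \bigcup_b (if `[< good b >] then digit_event b else set0).
  apply/seteqP; split=> x /=.
    move=> /(open_depends_finite idx oU) [n h].
    have sz : size (digits pushm x n) = n by apply: size_digits.
    exists (digits pushm x n) => //; case: asboolP => [_|]; last first.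
      case=> s; rewrite sz -(prefix_sample x) => /prefix_eq E.
      by apply: h => v vn; rewrite E.
    by rewrite /digit_event /= sz.
  move=> [b _]; case: asboolP => // gb; rewrite /digit_event /= => E.
  by apply: gb; rewrite prefix_sample.
apply: countable_bigcupT_measurable => [|b]; first exact: countableP.
by case: asboolP => _; [apply: measurable_digit_event|apply: measurable0].
Qed.

Lemma measure_finT (I : finType) (F : I -> set R) :
  (forall i, measurable (F i)) -> (forall i j, i != j -> F i `&` F j = set0) ->
  P (\bigcup_i F i) = (\sum_i P (F i))%E.
Proof.
move=> mF dF; rewrite measure_fin_bigcup //.
- by rewrite fsbig_finType.
- exact: finite_finset.
- by apply/trivIsetP => i j _ _; apply: dF.
- by move=> i _; apply: mF.
Qed.

Lemma cylinder_bound (E : set (V -> A)) : cylinder E ->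
  exists n, forall s s' : nat -> A, prefix s n = prefix s' n ->
    E (fun v => s (idx v)) -> E (fun v => s' (idx v)).
Proof.
move=> [xs H]; exists (\max_(v <- xs) (idx v).+1)%N => s s' /prefix_eq E1.
apply: H => x xin; apply: E1.
by elim: xs xin => //= y xs IH [->|/IH h]; rewrite big_cons leq_max ?leqnn // h orbT.
Qed.

(** The image of Lebesgue measure by the labels of nested intervals. *)
Lemma kolmogorov : exists nu : probability (borel_config V A) R,
  forall E : set (V -> A), cylinder E -> nu E = (m E)%:E.
Proof.
pose X : {mfun measurableTypeR R >-> borel_config V A} :=
  HB.pack sample_config (isMeasurableFun.Build _ _ _ _ _ measurable_sample_config).
exists (distribution P X) => E /cylinder_bound[n En].
pose E' : set (nat -> A) := [set s | E (fun v => s (idx v))].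
have mE : m E = pushm E'.
  rewrite /pushm; congr m; apply/seteqP; split=> om; rewrite /E' /=;
  by rewrite (_ : (fun _ => _) = om) //; apply/funext => v; rewrite lift_seqE.
pose good (b : n.-tuple A) := exists2 s, prefix s n = b & E' s.
rewrite mE; pose pre s : n.-tuple A := Tuple (introT eqP (size_prefix s n)).
rewrite (fa_partition fa_pushm pre).
rewrite /distribution /pushforward /=.
pose F (b : n.-tuple A) : set (measurableTypeR R) :=
  if `[< good b >] then digit_event b else set0.
have -> : X @^-1` E = \bigcup_b F b.
  apply/seteqP; split=> x /=.
    move=> Ex; exists (Tuple (introT eqP (size_digits pushm x n))) => //.
    rewrite /F; case: asboolP => [_|]; first by rewrite /digit_event /= size_digits.
    by case; exists (sample x); rewrite ?prefix_sample.
  move=> [b _]; rewrite /F; case: asboolP => // -[s sb Es].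
  rewrite /digit_event /= size_tuple -prefix_sample => E1.
  by apply: (En s) => //; rewrite sb E1.
rewrite measure_finT; last 2 first.
- by move=> b; rewrite /F; case: asboolP => _; [apply: measurable_digit_event|apply: measurable0].
- move=> b b' /eqP bb'; rewrite -subset0 => x [].
  rewrite /F; case: asboolP => // _; case: asboolP => // _.
  rewrite /digit_event /= !size_tuple => E1 E2.
  by apply: bb'; apply: val_inj; rewrite /= -E1 E2.
rewrite -sumEFin; apply: eq_bigr => b _.
rewrite /F; case: asboolP => [[s sb Es]|ng]; last first.
  rewrite measure0 (_ : _ `&` _ = set0) ?(fa_set0 fa_pushm) //.
  rewrite -subset0 => s [Es /= sb]; apply: ng; exists s => //.
  by rewrite -sb.
rewrite digit_event_prob /mass; congr (pushm _)%:E.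
rewrite size_tuple; apply/seteqP; split=> s' /=.
  by move=> sb'; split; [apply: (En s); rewrite ?sb ?sb'|apply: val_inj].
by move=> [_ <-].
Qed.

End Extension.

(** * Uniqueness of the Gibbs measure is uniform over boundary conditions *)

Import numFieldNormedType.Exports.

Lemma fsum_config (V : choiceType) (A : pointedFinType) (R : realType) (L : set V) :
  finite_set L -> exists (T : finType) (f : T -> (L -> A)), bijective f /\
    forall F : (L -> A) -> R, \sum_(s \in [set: L -> A]) F s = \sum_t F (f t).
Proof.
move=> fL; pose S := fset_set L.
have inL (y : S) : val y \in L by rewrite -in_fset_set ?(valP y).
have inS (x : L) : val x \in S by rewrite in_fset_set ?(valP x).
pose f (g : {ffun S -> A}) : L -> A := fun x => g [` inS x]%fset.
pose h (s : L -> A) : {ffun S -> A} := [ffun y => s (exist _ (val y) (inL y))].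
exists {ffun S -> A}, f.
have bf : bijective f.
  exists h; last first.
    by move=> s; apply/funext => x; rewrite /f /h ffunE; congr s; apply/val_inj.
  by move=> g; apply/ffunP => y; rewrite /f /h ffunE; congr (g _); apply/val_inj.
split=> // F; rewrite -fsbig_finType.
by rewrite (reindex_fsbigT f).
Qed.

Section Dlr.
Variables (R : realType) (V : choiceType) (e : rel V) (A : pointedFinType).
Variables (psi : V -> (V -> A) -> R) (r : nat).

Definition partition_function (L : set V) (t : boundary e r.*2 L -> A) : R :=
  \sum_(s' \in [set: L -> A]) expR (- energy psi s' t).

(** The Gibbs equations in L, without denominators: in this form they are closed
    conditions on m, and hold trivially for boundary conditions of probability
    zero. *)
Definition dlr (m : set (V -> A) -> R) (L : set V) :=
  forall (s : L -> A) (t : boundary e r.*2 L -> A),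
  m ([set om | pr om = s] `&` [set om | pr om = t]) * partition_function t =
  m [set om | pr om = t] * expR (- energy psi s t).

Lemma partition_function_gt0 (L : set V) (t : boundary e r.*2 L -> A) :
  finite_set L -> 0 < partition_function t.
Proof.
move=> fL; have [T [f [[h fh hf] E]]] := @fsum_config V A R L fL.
rewrite /partition_function E (bigD1 (h (fun=> point))) //=.
by rewrite ltr_pwDl ?expR_gt0 // sumr_ge0 // => *; apply: expR_ge0.
Qed.

Lemma pr_cylinder (W : set V) (t : W -> A) : finite_set W ->
  cylinder [set om : V -> A | pr om = t].
Proof.
move=> fW; exists (enum_fset (fset_set W)) => om om' E /= <-.
apply/funext => x; rewrite /pr; apply/esym/E.
have : val x \in enum_fset (fset_set W) by rewrite [_ \in _]in_fset_set ?(valP x).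
by elim: (enum_fset _) => //= y s IH; rewrite inE => /orP[/eqP ->|/IH]; [left|right].
Qed.

Lemma cylinderI (E F : set (V -> A)) :
  cylinder E -> cylinder F -> cylinder (E `&` F).
Proof.
move=> [xs Hx] [ys Hy]; exists (xs ++ ys) => om om' E1 [/= Eo Fo]; split.
  by apply: Hx Eo => x xin; apply: E1; apply/List.in_or_app; left.
by apply: Hy Fo => x xin; apply: E1; apply/List.in_or_app; right.
Qed.

Hypothesis fb : forall r (L : set V), finite_set L -> finite_set (boundary e r L).

Lemma gibbs_of_dlr (m : set (V -> A) -> R)
    (nu : probability (borel_config V A) R) :
  (forall E, cylinder E -> nu E = (m E)%:E) ->
  (forall L, finite_set L -> dlr m L) -> gibbs e psi r nu.
Proof.
move=> nuE md L fL s t F F0.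
have cF : cylinder F by apply: pr_cylinder; apply: fb.
have cS : cylinder [set om : V -> A | pr om = s] by apply: pr_cylinder.
rewrite /cond_prob (nuE _ (cylinderI cS cF)) (nuE _ cF) /=.
have mF : 0 < m F by move: F0; rewrite (nuE _ cF) lte_fin.
have Z0 := partition_function_gt0 t fL.
apply/eqP; rewrite eqr_div ?lt0r_neq0 //.
by apply/eqP; rewrite (md L fL s t) mulrC.
Qed.

End Dlr.

Section UltraLimit.
Variables (R : realType) (U : set_system nat).
Hypothesis uU : UltraFilter U.

Lemma ultra_bounded_cvg (x : nat -> R) :
  (forall n, 0 <= x n <= 1) -> exists p : R, x @ U --> p.
Proof.
move=> x01; have pU : ProperFilter U by apply: ultra_proper.
have Ux : U (x @^-1` `[0, 1]%classic).
  by apply: filterE => n; rewrite /= in_itv /=; apply: x01.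
have [p [_ cl]] := @segment_compact R 0 1 (x @ U) _ Ux.
exists p => B nB; have [UB|UnB] := in_ultra_setVsetC (x @^-1` B) uU; first exact: UB.
have [y [/= nBy By]] := cl (~` B) B UnB nB.
by [].
Qed.

Variables (T : Type) (mm : nat -> set T -> R).
Hypothesis fmm : forall n, fa_prob (mm n).

Lemma ultra_fa : exists m : set T -> R, fa_prob m /\
  forall E, (fun n => mm n E) @ U --> m E.
Proof.
have pU : ProperFilter U by apply: ultra_proper.
have [m mP] : {m : set T -> R & forall E, (fun n => mm n E) @ U --> m E}.
  apply: (@choice _ _ (fun E p => (fun n => mm n E) @ U --> p)) => E.
  by apply: ultra_bounded_cvg => n; rewrite fa_ge0 ?fa_le1.
have eqU (f : nat -> R) (p c : R) : f @ U --> p -> (\forall n \near U, f n = c) -> p = c.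
  by move=> fp fc; apply: (closed_cvg [set x : R | x = c] _ fc _ fp); apply: closed_eq.
exists m; split=> //; split.
- by apply: (eqU _ _ _ (mP setT)); apply: filterE => n; rewrite fa_setT.
- move=> E; change ([set x : R | 0 <= x] (m E)); apply: (closed_cvg [set x : R | 0 <= x] _ _ _ (mP E)); first exact: closed_ge.
  by apply: filterE => n; apply: fa_ge0.
- move=> E F EF; apply: subr0_eq.
  apply: (eqU (fun n => mm n (E `|` F) - (mm n E + mm n F))).
    by apply: cvgB => //; apply: cvgD.
  by apply: filterE => n; rewrite fa_setU ?subrr.
Qed.

End UltraLimit.

Section Uniqueness.
Variables (R : realType) (V : choiceType) (e : rel V) (A : pointedFinType).
Variables (psi : V -> (V -> A) -> R) (r d : nat).
Hypothesis hT : regular_tree e d.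
Variable mu : probability (borel_config V A) R.
Hypothesis hmu : unique_gibbs e psi r mu.

(** If every N had a counterexample, a limit of these along an ultrafilter would
    satisfy all the Gibbs equations and extend to a Borel probability, hence be
    mu, although its value at E differs from that of mu. *)
Lemma uniform_uniqueness (u : V) (E : set (V -> A)) (eps : R) :
  cylinder E -> 0 < eps ->
  exists N, forall m, fa_prob m ->
    (forall L, finite_set L -> L `<=` ball_in e u N -> dlr e psi r m L) ->
    `|m E - fine (mu E)| <= eps.
Proof.
move=> cE eps0; apply: contrapT => /forallNP H.
have [mm mmP] : {mm : nat -> set (V -> A) -> R & forall N, [/\ fa_prob (mm N),
    forall L, finite_set L -> L `<=` ball_in e u N -> dlr e psi r (mm N) L &
    eps < `|mm N E - fine (mu E)|]}.
  apply: (@choice _ _ (fun N m => [/\ fa_prob m,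
    forall L, finite_set L -> L `<=` ball_in e u N -> dlr e psi r m L &
    eps < `|m E - fine (mu E)|])) => N.
  have /existsNP[m /not_implyP[fm /not_implyP[dm /negP]]] := H N.
  by rewrite -ltNge => me; exists m.
have [U [uU sU]] := ultraFilterLemma eventually_filter.
have pU : ProperFilter U by apply: ultra_proper.
have fmm n : fa_prob (mm n) by case: (mmP n).
have [m [fm mP]] := ultra_fa uU fmm.
have [w0 [rw0 gw0]] : exists w : seq 'I_d, reduced w /\ gdist e u u = size w.
  exists [::]; split=> //; apply/eqP; rewrite -leqn0; apply: (gdist_le (n := 0)).
  by exists [::].
have [word [nb [col _]]] := tree_coloring hT rw0 gw0.
have [nu nuE] := kolmogorov (inj_comp (pcan_inj pickleK) (word_inj col)) fm.
have md L : finite_set L -> dlr e psi r m L.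
  move=> fL s t; apply: subr0_eq.
  have [N0 LN] : exists N0, L `<=` ball_in e u N0.
    exists (\max_(x <- fset_set L) gdist e u x)%N => x Lx.
    rewrite /ball_in /=; apply: (leq_bigmax_seq (F := fun x => gdist e u x)) => //.
    by rewrite in_fset_set ?inE.
  pose f n := mm n ([set om | pr om = s] `&` [set om | pr om = t]) *
      partition_function psi t -
    mm n [set om | pr om = t] * expR (- energy psi s t).
  have fl : f @ U --> m ([set om | pr om = s] `&` [set om | pr om = t]) *
      partition_function psi t - m [set om | pr om = t] * expR (- energy psi s t).
    by apply: cvgB; apply: cvgMl.
  apply: (closed_cvg [set x : R | x = 0] _ _ _ fl); first exact: closed_eq.
  apply: sU; exists N0 => // n /= Nn; apply/eqP; rewrite subr_eq0; apply/eqP.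
  case: (mmP n) => _ dn _; apply: dn => //.
  by move=> x /LN; rewrite /ball_in /= => /leq_trans; apply.
have fb r' (L : set V) : finite_set L -> finite_set (boundary e r' L).
  exact: (finite_boundary hT col).
have gnu : gibbs e psi r nu by apply: (gibbs_of_dlr fb nuE md).
have Emu : nu E = mu E by apply: hmu.2 => //; apply: cylinder_measurable.
have mE : m E = fine (mu E) by rewrite -Emu nuE.
suff : eps <= `|m E - fine (mu E)| by rewrite mE subrr normr0 leNgt eps0.
have cN : (fun n => `|mm n E - fine (mu E)|) @ U --> `|m E - fine (mu E)|.
  by apply: cvg_norm; apply: cvgB => //; apply: cvg_cst.
change ([set x : R | eps <= x] `|m E - fine (mu E)|).
apply: (closed_cvg [set x : R | eps <= x] _ _ _ cN); first exact: closed_ge.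
by apply: filterE => n; case: (mmP n) => _ _ /ltW.
Qed.

End Uniqueness.

(** * Gibbs measures on finite graphs covered by the tree *)

Lemma fsum_finset (R : realType) (I : finType) (B : set I) (F : I -> R) :
  \sum_(i \in B) F i = \sum_(i | i \in B) F i.
Proof.
rewrite fsbig_mkcond fsbig_finType [RHS]big_mkcond; apply: eq_bigr => i _.
by rewrite /patch.
Qed.

Section LocalGibbs.
Variables (R : realType) (V : choiceType) (e : rel V) (A : pointedFinType).
Variables (psi : V -> (V -> A) -> R) (r d : nat).
Hypothesis hT : regular_tree e d.
Hypothesis hsym : symmetric_potential e psi.
Hypothesis hrange : forall v, depends_on_ball e psi v r.

Lemma psi_local v om om' : (forall x, (gdist e v x <= r)%N -> om x = om' x) ->
  psi v om = psi v om'.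
Proof.
move=> E; have [psi' ->] := hrange v; rewrite /=; congr psi'.
by apply/funext => x; apply: E; exact: (set_mem (valP x)).
Qed.

Lemma eval_on_pr (W : set V) v om : ball_in e v r `<=` W ->
  eval_on psi v (pr om : W -> A) = psi v om.
Proof.
move=> bW; rewrite /eval_on; case: xgetP => [y -> [om' /= E <-]|/(_ (psi v om))].
  apply: psi_local => x /bW Wx.
  by have := congr1 (fun f => f (exist _ x (mem_set Wx))) E.
by case; exists om.
Qed.

Lemma glue_pr (L M : set V) (om : V -> A) (s : L -> A) (t : M -> A) :
  pr om = s -> pr om = t -> Defs.glue s t = pr om.
Proof.
move=> <- <-; apply/funext => x; rewrite /Defs.glue /pr.
by case: pselect.
Qed.

Variables (u0 : V) (word0 : V -> seq 'I_d) (nb0 : 'I_d -> V -> V).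
Hypothesis col0 : coloring e u0 word0 nb0.

Let Dtri x y z : (gdist e x z <= gdist e x y + gdist e y z)%N.
Proof. exact: (gdist_triangle hT col0). Qed.

Lemma ball_sub_boundary (L : set V) v : (L `|` boundary e r L) v ->
  ball_in e v r `<=` L `|` boundary e r.*2 L.
Proof.
move=> Lv x; rewrite /ball_in /= => vx.
have [Lx|nLx] := pselect (L x); [by left|right; split=> //].
case: Lv => [Lv|[_ [w Lw wv]]]; first by exists v => //; rewrite -addnn (leq_trans vx) // leq_addr.
by exists w => //; rewrite -addnn (leq_trans (Dtri _ v _)) // leq_add.
Qed.

Lemma energyE (L : set V) (s : L -> A) (t : boundary e r.*2 L -> A) om :
  pr om = s -> pr om = t ->
  energy psi s t = \sum_(v \in L `|` boundary e r L) psi v om.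
Proof.
move=> Es Et; apply: eq_fsbigr => v; rewrite inE => Lv.
by rewrite (glue_pr Es Et) eval_on_pr //; apply: ball_sub_boundary.
Qed.

Variables (Om : finType) (sg : 'I_d -> Om -> Om).
Hypothesis sgK : forall c, involutive (sg c).

(** The potential on the finite graph: psi at the root of the tree, for the
    coloring pulled back by the covering based at z. *)
Definition lift_psi (z : Om) (x : {ffun Om -> A}) : R :=
  psi u0 (fun v => x (cover word0 sg z v)).

Definition gibbs_weight (x : {ffun Om -> A}) : R :=
  expR (- \sum_z lift_psi z x).

(** Moving the base point of a covering changes it by an automorphism of the tree,
    under which psi is invariant. *)
Lemma lift_psi_cover (u : V) (word : V -> seq 'I_d) (nb : 'I_d -> V -> V) y v
    (x : {ffun Om -> A}) : coloring e u word nb ->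
  psi v (fun z => x (cover word sg y z)) = lift_psi (cover word sg y v) x.
Proof.
move=> col; have [g [ginv [ag gu cg]]] := deck col col0 v.
have /(_ _ _ ag u0 (fun z => x (cover word0 sg (cover word sg y v) z))) := hsym.
rewrite gu /lift_psi => <-; congr (psi v); apply/funext => z /=.
rewrite -cg //; by case: ag => _ -> _.
Qed.

Section Law.
Variables (u : V) (word : V -> seq 'I_d) (nb : 'I_d -> V -> V).
Hypothesis col : coloring e u word nb.
Variables (y : Om) (N : nat).
Hypothesis girth : large_girth sg (N + r.*2).*2.
Variable far : {ffun Om -> A} -> bool.
Local Notation cov := (cover word sg y).
Hypothesis far_indep : forall x x' : {ffun Om -> A},
  (forall z, (forall v, ball_in e u N v -> z <> cov v) -> x z = x' z) ->
  far x = far x'.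

(** Conditioning on the event far, which does not involve the colors near y, will
    not affect the Gibbs equations near the root of the tree. *)
Definition far_weight x := gibbs_weight x * (far x)%:R.
Definition far_mass := \sum_x far_weight x.
Definition far_law (E : set (V -> A)) : R :=
  (\sum_x far_weight x * `[< E (fun v => x (cov v)) >]%:R) / far_mass.

Hypothesis far_pos : exists x, far x.

Lemma far_weight_ge0 x : 0 <= far_weight x.
Proof. by rewrite mulr_ge0 ?expR_ge0. Qed.

Lemma far_mass_gt0 : 0 < far_mass.
Proof.
have [x fx] := far_pos; rewrite /far_mass (bigD1 x) //=.
rewrite ltr_pwDl ?sumr_ge0 // => [|? _]; last exact: far_weight_ge0.
by rewrite /far_weight fx mulr1 expR_gt0.
Qed.

Lemma fa_far_law : fa_prob far_law.
Proof.
split.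
- rewrite /far_law (eq_bigr far_weight) ?divff ?gt_eqF ?far_mass_gt0 // => x _.
  by rewrite asboolT // mulr1.
- move=> E; rewrite divr_ge0 ?(ltW far_mass_gt0) // sumr_ge0 // => x _.
  by rewrite mulr_ge0 ?far_weight_ge0.
move=> E F EF; rewrite /far_law -mulrDl -big_split /=; congr (_ / _).
apply: eq_bigr => x _; rewrite -mulrDr; congr (_ * _).
case: (asboolP (E _)) => Ex; case: (asboolP (F _)) => Fx.
- by exfalso; have : (E `&` F) (fun v => x (cov v)) by []; rewrite EF.
- by rewrite asboolT ?addr0 //; left.
- by rewrite asboolT ?add0r //; right.
- by rewrite asboolF ?addr0 // => -[].
Qed.

(** Summing over s' restores the normalization. *)
Lemma dlr_of_ratio (m : set (V -> A) -> R) (L : set V) : fa_prob m ->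
  finite_set L ->
  (forall (s s' : L -> A) (t : boundary e r.*2 L -> A),
    m ([set om | pr om = s] `&` [set om | pr om = t]) * expR (- energy psi s' t) =
    m ([set om | pr om = s'] `&` [set om | pr om = t]) * expR (- energy psi s t)) ->
  dlr e psi r m L.
Proof.
move=> fm fL H s t; have [T [f [[h fh hf] E]]] := @fsum_config V A R L fL.
rewrite /partition_function E mulr_sumr.
rewrite [in RHS](fa_partition fm (fun om => h (pr om))) mulr_suml.
apply: eq_bigr => i _; rewrite H; congr (m _ * _).
rewrite setIC; congr (_ `&` _); apply/seteqP; split=> om /= E1.
  by rewrite E1 fh.
by rewrite -E1 hf.
Qed.

Section Overwrite.
Variable L : set V.
Hypothesis LN : L `<=` ball_in e u N.
Hypothesis fL : finite_set L.

Definition overwrite (s : L -> A) (x : {ffun Om -> A}) : {ffun Om -> A} :=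
  [ffun z => if pselect (exists v : L, cov (val v) = z) is left h
             then s (projT1 (cid h)) else x z].

Let W := L `|` boundary e r.*2 L.

Let Wball : W `<=` ball_in e u (N + r.*2).
Proof.
move=> v [/LN|[_ [w /LN]]]; rewrite /ball_in /= => h; first by rewrite (leq_trans h) // leq_addr.
by move=> wv; rewrite (leq_trans (Dtri _ w _)) // leq_add.
Qed.

Let cov_inj v v' : W v -> W v' -> cov v = cov v' -> v = v'.
Proof. by move=> /Wball hv /Wball hv'; apply: (cover_inj hT col sgK girth hv hv'). Qed.

Lemma overwrite_in s x (v : L) : overwrite s x (cov (val v)) = s v.
Proof.
rewrite ffunE; case: pselect => [h|[]]; last by exists v.
case: cid => v' /= E; congr s; apply: val_inj; apply: cov_inj E.
  by left; exact: (set_mem (valP v')).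
by left; exact: (set_mem (valP v)).
Qed.

Lemma overwrite_out s x z : (forall v, L v -> cov v <> z) -> overwrite s x z = x z.
Proof.
move=> H; rewrite ffunE; case: pselect => // -[v E].
by case: (H (val v) (set_mem (valP v))).
Qed.

Lemma pr_overwrite s x : pr (fun v => overwrite s x (cov v)) = s.
Proof. by apply/funext => v; rewrite /pr overwrite_in. Qed.

Lemma pr_overwrite_boundary s x :
  pr (fun v => overwrite s x (cov v)) =
  pr (fun v => x (cov v)) :> (boundary e r.*2 L -> A).
Proof.
apply/funext => v; rewrite /pr overwrite_out // => v' Lv' E.
have [nLv Bv] := set_mem (valP v).
by apply: (nLv); rewrite -(cov_inj (or_introl Lv') (or_intror (conj nLv Bv)) E).
Qed.

Lemma overwriteK s s' (x : {ffun Om -> A}) : pr (fun v => x (cov v)) = s ->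
  overwrite s (overwrite s' x) = x.
Proof.
move=> xs; apply/ffunP => z; rewrite ffunE; case: pselect => [h|nh].
  by case: cid => v /= <-; rewrite -xs.
by apply: overwrite_out => v Lv E; apply: nh; exists (exist _ v (mem_set Lv)).
Qed.

(** Only the energy terms based in the image of the r-neighborhood of L see the
    change, and by large girth each of them is the term of exactly one vertex of
    the tree. *)
Lemma weight_overwrite s s' (t : boundary e r.*2 L -> A) (x : {ffun Om -> A}) :
  pr (fun v => x (cov v)) = s -> pr (fun v => x (cov v)) = t ->
  far_weight x * expR (- energy psi s' t) =
  far_weight (overwrite s' x) * expR (- energy psi s t).
Proof.
move=> xs xt; set x' := overwrite s' x.
have x's : pr (fun v => x' (cov v)) = s' by apply: pr_overwrite.
have x't : pr (fun v => x' (cov v)) = t by rewrite pr_overwrite_boundary.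
have Ef : far x = far x'.
  apply: far_indep => z H; rewrite /x' overwrite_out // => v /LN Lv E.
  exact: (H v Lv).
rewrite /far_weight -Ef !(mulrAC _ (far x)%:R); congr (_ * _).
rewrite /gibbs_weight -!expRD; congr expR.
rewrite (energyE xs xt) (energyE x's x't).
pose M := L `|` boundary e r L.
have MW : M `<=` W.
  move=> v [Lv|[nLv [w Lw wv]]]; [by left|right; split=> //].
  by exists w => //; rewrite (leq_trans wv) // -addnn leq_addr.
pose cM := cov @` M.
have sumM (z : {ffun Om -> A}) :
    \sum_(v \in M) psi v (fun v0 => z (cov v0)) = \sum_(z0 | z0 \in cM) lift_psi z0 z.
  rewrite -fsum_finset fsbig_image; last first.
    by move=> a b; rewrite !inE => /MW Wa /MW Wb; apply: cov_inj.
  by apply: eq_fsbigr => v _; rewrite (lift_psi_cover _ _ _ col).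
rewrite !sumM (bigID (mem cM)) /= [in RHS](bigID (mem cM)) /=.
have -> : \sum_(i | i \notin cM) lift_psi i x' = \sum_(i | i \notin cM) lift_psi i x.
  apply: eq_bigr => z zM; apply: psi_local => v u0v.
  rewrite /x' overwrite_out // => v0 Lv0 E.
  have sw : (size (word0 v) <= r)%N.
    have [w [sw vE]] := gdist_act hT col0 u0 v.
    rewrite vE (word_act col0) (word_root col0).
    by rewrite (leq_trans (size_act_lmul _ _)) // addn0 sw.
  have zE : z = cov (act nb (rev (word0 v)) v0).
    by rewrite (cover_act col sgK) E /cover act_revK.
  move/negP: zM; apply; rewrite inE; exists (act nb (rev (word0 v)) v0) => //.
  have [Lv'|nLv'] := pselect (L (act nb (rev (word0 v)) v0)); [by left|right].
  split=> //; exists v0 => //.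
  by rewrite (leq_trans (gdist_act_le col _ _)) // size_rev.
ring.
Qed.

Lemma far_law_ratio (s s' : L -> A) (t : boundary e r.*2 L -> A) :
  far_law ([set om | pr om = s] `&` [set om | pr om = t]) * expR (- energy psi s' t) =
  far_law ([set om | pr om = s'] `&` [set om | pr om = t]) * expR (- energy psi s t).
Proof.
rewrite /far_law !(mulrAC _ far_mass^-1); congr (_ / _); rewrite !mulr_suml.
have drop s1 s2 : \sum_(x : {ffun Om -> A}) far_weight x *
    `[< ([set om | pr om = s1] `&` [set om | pr om = t]) (fun v => x (cov v)) >]%:R
    * expR (- energy psi s2 t) =
  \sum_(x : {ffun Om -> A} | `[< ([set om | pr om = s1] `&` [set om | pr om = t]) (fun v => x (cov v)) >])
    far_weight x * expR (- energy psi s2 t).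
  rewrite [RHS]big_mkcond; apply: eq_bigr => x _.
  by case: ifP; rewrite ?mulr1 // mulr0 mul0r.
rewrite !drop.
rewrite [RHS](reindex_onto (overwrite s') (overwrite s)) /=; last first.
  by move=> x /asboolP[/= xs _]; apply: overwriteK.
apply: congr_big => //; last first.
  by move=> x /asboolP[/= xs xt]; apply: weight_overwrite.
move=> x; apply/asboolP/andP => [[/= xs xt]|[/asboolP[/= xs xt] /eqP E]].
  split; last by apply/eqP; apply: overwriteK.
  by apply/asboolP; split; rewrite /= ?pr_overwrite ?pr_overwrite_boundary.
split=> /=; first by rewrite -E pr_overwrite.
by move: xt; rewrite pr_overwrite_boundary.
Qed.

End Overwrite.

Lemma dlr_far_law (L : set V) : finite_set L -> L `<=` ball_in e u N ->
  dlr e psi r far_law L.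
Proof.
by move=> fL LN; apply: dlr_of_ratio => //; [exact: fa_far_law|exact: far_law_ratio].
Qed.

End Law.
End LocalGibbs.

(** * Counting permutations that match two colorings *)

Section PermutationCount.
Variables (X A : finType).
Implicit Types (s t : X -> A).

Definition fiber s a : {set X} := [set x | s x == a].
(** The order of the stabilizer of s in the symmetric group. *)
Definition type_factor s : nat := (\prod_a (#|fiber s a|)`!)%N.

Lemma stabilizer_fiber s (p : {perm X}) : (forall x, s (p x) = s x) ->
  forall a, p \in ('N(fiber s a | 'P))%g.
Proof.
by move=> ps a; apply/action.astabsP => x; rewrite !inE /= /aperm ps.
Qed.

Lemma card_stabilizer s :
  (#|[pred p : {perm X} | [forall x, s (p x) == s x]]| <= type_factor s)%N.
Proof.
pose f (p : {perm X}) := [ffun a => restr_perm (fiber s a) p].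
rewrite -(card_in_imset (f := f)).
  apply: (@leq_trans #|family (fun a => perm_on (fiber s a))|).
    apply: subset_leq_card; apply/fintype.subsetP => _ /imsetP[p _ ->].
    by apply/familyP => a; rewrite ffunE; apply: restr_perm_on.
  rewrite card_family /type_factor foldrE big_map big_enum /=.
  by apply: leq_prod => a _; rewrite card_perm.
move=> p q; rewrite !inE => /forallP ps /forallP qs /ffunP E.
apply/perm.permP => x; have := E (s x); rewrite !ffunE => /perm.permP /(_ x).
have pN := stabilizer_fiber (fun y => eqP (ps y)) (s x).
have qN := stabilizer_fiber (fun y => eqP (qs y)) (s x).
by rewrite (restr_permE pN) ?(restr_permE qN) ?inE.
Qed.

(** Two permutations that match s with t differ by one that preserves s. *)
Lemma card_perm_matching s t :
  (#|[pred p : {perm X} | [forall x, s (p x) == t x]]| <= type_factor s)%N.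
Proof.
case: (pickP [pred p : {perm X} | [forall x, s (p x) == t x]]) => [p0 /forallP p0s|no].
  apply: leq_trans (card_stabilizer s).
  rewrite -(card_imset _ (@mulgI _ (p0^-1)%g)).
  apply: subset_leq_card; apply/fintype.subsetP => _ /imsetP[p + ->].
  rewrite !inE => /forallP ps; apply/forallP => x.
  by rewrite permM (eqP (ps _)) -(eqP (p0s _)) permKV.
by rewrite eq_card0 // => p; rewrite !inE; exact: no p.
Qed.

Variables (R : realFieldType) (J : finType).

(** Group the families p by the sequence of labels that they produce: a sequence
    comes from at most [type_factor (s j)] permutations for each j, and the
    product weights of all the sequences add up to one. *)
Lemma sum_perm_weight (s : J -> X -> A) (rho : {ffun J -> A} -> R) :
  (forall v, 0 <= rho v) -> \sum_v rho v = 1 ->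
  \sum_(p : {ffun J -> {perm X}}) \prod_x rho [ffun j => s j (p j x)]
    <= \prod_j (type_factor (s j))%:R.
Proof.
move=> rho0 rho1.
pose tau (p : {ffun J -> {perm X}}) : {ffun X -> {ffun J -> A}} :=
  [ffun x => [ffun j => s j (p j x)]].
rewrite (partition_big tau xpredT) //=.
have -> : \prod_j (type_factor (s j))%:R =
    \sum_(t : {ffun X -> {ffun J -> A}}) (\prod_x rho (t x)) *
      \prod_j (type_factor (s j))%:R :> R.
  rewrite -mulr_suml -(bigA_distr_bigA (fun _ => rho)) /=.
  by rewrite rho1 big1_eq mul1r.
apply: ler_sum => t _.
have -> : \sum_(p | tau p == t) \prod_x rho [ffun j => s j (p j x)] =
    \sum_(p | tau p == t) \prod_x rho (t x).
  by apply: eq_bigr => p /eqP <-; apply: eq_bigr => x _; rewrite /tau ffunE.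
rewrite sumr_const -[leLHS]mulr_natr ler_wpM2l ?prodr_ge0 //.
rewrite -natr_prod ler_nat.
apply: (@leq_trans #|family (fun j => [pred p : {perm X} | [forall x, s j (p x) == t x j]])|).
  apply: subset_leq_card; apply/fintype.subsetP => p pt; have tp : tau p = t by apply/eqP.
  apply/familyP => j; rewrite inE; apply/forallP => x.
  by rewrite -tp !ffunE.
rewrite card_family foldrE big_map big_enum /=.
by apply: leq_prod => j _; apply: card_perm_matching.
Qed.

End PermutationCount.

(** * Factorials and the entropy of color frequencies *)

Section LogFactorial.
Variable R : realType.

Lemma ln_prod (I : finType) (f : I -> R) :
  (forall i, 0 < f i) -> ln (\prod_i f i) = \sum_i ln (f i).
Proof.
move=> f0; apply: expR_inj; rewrite lnK ?posrE ?prodr_gt0 // expR_sum.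
by apply: eq_bigr => i _; rewrite lnK ?posrE.
Qed.

Lemma le_lnD1 (x : R) : 0 < x -> ln x <= x - 1.
Proof.
move=> x0; rewrite -ler_expR lnK ?posrE //.
by have := expR_ge1Dx (x - 1); rewrite addrC subrK.
Qed.

Lemma ln_sub_le (x y : R) : 0 < x -> 0 < y -> ln y - ln x <= (y - x) / x.
Proof.
move=> x0 y0; rewrite -ln_div //.
have -> : (y - x) / x = y / x - 1 by field; rewrite gt_eqF.
by apply: le_lnD1; apply: divr_gt0.
Qed.

Lemma ln_fact_ge n : n%:R * ln n%:R - n%:R <= ln (n`!)%:R :> R.
Proof.
elim: n => [|n IH]; first by rewrite mul0r subr0 fact0 ln1.
rewrite factS natrM lnM ?posrE ?ltr0n ?fact_gt0 //.
case: n IH => [_|n IH]; first by rewrite fact0 ln1 addr0 mul1r lerBlDr lerDl.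
have h : n.+1%:R * (ln n.+2%:R - ln n.+1%:R) <= 1 :> R.
  have := @ln_sub_le n.+1%:R n.+2%:R; rewrite !ltr0n => /(_ isT isT).
  rewrite -(natrB _ (leqnSn _)) subSnn => h.
  by rewrite mulrC -ler_pdivlMr ?ltr0n.
rewrite -(natr1 n.+1) in h *; lra.
Qed.

Lemma ln_fact_le k n : (k <= n)%N -> (0 < n)%N ->
  ln (k`!)%:R <= k%:R * ln k%:R - k%:R + ln n%:R + 1 :> R.
Proof.
move=> kn n0; case: k kn => [_|k kn].
  by rewrite fact0 ln1 mul0r subr0 add0r addr_ge0 // ln_ge0 // ler1n.
have lkn : ln k.+1%:R <= ln n%:R :> R by rewrite ler_ln ?posrE ?ltr0n ?ler_nat.
suff : ln ((k.+1)`!)%:R <= k.+1%:R * ln k.+1%:R - k.+1%:R + ln k.+1%:R + 1 :> R by lra.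
elim: k {kn lkn} => [|k IH]; first by rewrite ln1; lra.
rewrite factS natrM lnM ?posrE ?ltr0n ?fact_gt0 //.
have h : 1 <= k.+2%:R * (ln k.+2%:R - ln k.+1%:R) :> R.
  have := @ln_sub_le k.+2%:R k.+1%:R; rewrite !ltr0n => /(_ isT isT).
  rewrite -[k.+1%:R - _]opprB -(natrB _ (leqnSn _)) subSnn mulN1r.
  rewrite -opprB lerN2 => h.
  by rewrite mulrC -ler_pdivrMr ?ltr0n // mul1r.
rewrite -(natr1 k.+1) in h *; lra.
Qed.

(** The tangent inequality ln q <= ln p + (q - p) / p, multiplied by q. Its error
    is quadratic, also near q = 0, and can be averaged over random q. *)
Lemma eta_ge (p q : R) : 0 < p -> 0 <= q ->
  - (p * ln p) - (1 + ln p) * (q - p) - (q - p) ^+ 2 / p <= - (q * ln q).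
Proof.
move=> p0; rewrite le_eqVlt => /orP[/eqP <-|q0].
  have -> : (0 - p) ^+ 2 / p = p by field; rewrite gt_eqF.
  lra.
have h := ler_wpM2l (ltW q0) (ln_sub_le p0 q0).
have E : q * ((q - p) / p) = (q - p) ^+ 2 / p + (q - p).
  by field; rewrite gt_eqF.
rewrite E in h; lra.
Qed.

(** By Stirling's formula the logarithm of the multinomial coefficient is #|X|
    times the entropy of the frequencies q, up to a logarithmic term; then
    [eta_ge] compares this with the entropy of p. *)
Lemma ln_type_factor_le (A X : finType) (s : X -> A) (p q : A -> R) :
  (0 < #|X|)%N -> (forall a, 0 < p a) ->
  (forall a, q a = #|fiber s a|%:R / #|X|%:R) ->
  ln (type_factor s)%:R <= ln ((#|X|)`!)%:R + #|A|%:R * (ln #|X|%:R + 1)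
    - #|X|%:R * (- \sum_a p a * ln (p a) - \sum_a (1 + ln (p a)) * (q a - p a)
                 - \sum_a (q a - p a) ^+ 2 / p a).
Proof.
have [n nE] : exists n, n = #|X| by exists #|X|.
rewrite -nE => n0 p0 qE.
have nR : 0 < n%:R :> R by rewrite ltr0n.
have fib a : (#|fiber s a| <= n)%N by rewrite nE max_card.
have sumn : (\sum_a #|fiber s a| = n)%N.
  rewrite nE -sum1_card (partition_big s xpredT) //=; apply: eq_bigr => a _.
  by rewrite -sum1_card; apply: eq_bigl => x; rewrite inE.
have n0' : n%:R != 0 :> R by rewrite gt_eqF.
have term a : ln ((#|fiber s a|)`!)%:R <= n%:R * (q a * ln (q a))
    + #|fiber s a|%:R * (ln n%:R - 1) + (ln n%:R + 1) :> R.
  apply: (le_trans (ln_fact_le (fib a) n0)).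
  have -> : n%:R * (q a * ln (q a)) = #|fiber s a|%:R * (ln #|fiber s a|%:R - ln n%:R).
    rewrite mulrA [n%:R * _]mulrC {1}qE divfK // qE.
    have [->|f0] := posnP #|fiber s a|; first by rewrite !mul0r.
    by rewrite ln_div ?posrE ?ltr0n.
  lra.
have eta a : n%:R * (q a * ln (q a)) <= n%:R * (p a * ln (p a) +
    (1 + ln (p a)) * (q a - p a) + (q a - p a) ^+ 2 / p a).
  have q0 : 0 <= q a by rewrite qE divr_ge0.
  rewrite ler_wpM2l ?(ltW nR) //; have := @eta_ge (p a) (q a) (p0 a).
  rewrite q0 => /(_ isT); move: (_ / p a) (q a * ln _) => w z; lra.
rewrite /type_factor natr_prod ln_prod; last by move=> a; rewrite ltr0n fact_gt0.
apply: (@le_trans _ _ (\sum_a (n%:R * (p a * ln (p a) +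
    (1 + ln (p a)) * (q a - p a) + (q a - p a) ^+ 2 / p a)
    + #|fiber s a|%:R * (ln n%:R - 1) + (ln n%:R + 1)))).
  by apply: ler_sum => a _; apply: (le_trans (term a)); rewrite !lerD2r.
have EA : \sum_(a : A) (ln n%:R + 1) = #|A|%:R * (ln n%:R + 1) :> R.
  by rewrite sumr_const [RHS]mulr_natl.
rewrite big_split /= EA big_split /= -mulr_sumr !big_split /= -mulr_suml -natr_sum sumn.
have := ln_fact_ge n; set S1 := \sum_i p i * _; set S2 := \sum_i (1 + _) * _; set S3 := \sum_i _ / p i.
lra.
Qed.

End LogFactorial.

(** * The first-moment inequality *)

Section Expectation.
Variables (R : realType) (S : finType) (w : S -> R).
Hypotheses (w0 : forall s, 0 <= w s) (w1 : \sum_s w s = 1).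

Definition Ex (f : S -> R) := \sum_s w s * f s.

Lemma ExD f g : Ex (fun s => f s + g s) = Ex f + Ex g.
Proof. by rewrite /Ex -big_split; apply: eq_bigr => s _; rewrite mulrDr. Qed.

Lemma ExZ a f : Ex (fun s => a * f s) = a * Ex f.
Proof. by rewrite /Ex mulr_sumr; apply: eq_bigr => s _; rewrite mulrCA. Qed.

Lemma ExN f : Ex (fun s => - f s) = - Ex f.
Proof. by rewrite /Ex -sumrN; apply: eq_bigr => s _; rewrite mulrN. Qed.

Lemma Ex_cst a : Ex (fun=> a) = a.
Proof. by rewrite /Ex -mulr_suml w1 mul1r. Qed.

Lemma Ex_sum (I : finType) (f : I -> S -> R) :
  Ex (fun s => \sum_i f i s) = \sum_i Ex (f i).
Proof. by rewrite /Ex exchange_big; apply: eq_bigr => s _; rewrite mulr_sumr. Qed.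

Lemma Ex_le f g : (forall s, f s <= g s) -> Ex f <= Ex g.
Proof. by move=> fg; apply: ler_sum => s _; rewrite ler_wpM2l. Qed.

Lemma Ex_attained f : exists s, Ex f <= f s.
Proof.
apply: contrapT => /forallNP H.
have lt s : f s < Ex f by rewrite ltNge; apply/negP/H.
have [s ws] : exists s, 0 < w s.
  apply: contrapT => /forallNP W; have : (0 : R) < 1 by [].
  rewrite -w1 big1 ?ltxx // => s _; apply/le_anti; rewrite w0 andbT.
  by rewrite leNgt; apply/negP/W.
have : Ex f < \sum_s w s * Ex f.
  rewrite {1}/Ex; move: (Ex f) lt => c lt; rewrite (bigD1 s) //= [ltRHS](bigD1 s) //=.
  apply: ltr_leD; first by rewrite ltr_pM2l.
  by apply: ler_sum => i _; rewrite ler_wpM2l // ltW.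
by rewrite -mulr_suml w1 mul1r ltxx.
Qed.

Definition Pr (P : pred S) := Ex (fun s => (P s)%:R).

Lemma eq_Pr (P P' : pred S) : P =1 P' -> Pr P = Pr P'.
Proof. by move=> PP'; apply: eq_bigr => s _; rewrite PP'. Qed.

Lemma Ex_law (T : finType) (Y : S -> T) (F : T -> R) :
  Ex (fun s => F (Y s)) = \sum_t F t * Pr (fun s => Y s == t).
Proof.
rewrite -(eq_bigr _ (fun t _ => ExZ (F t) _)) -Ex_sum; apply: eq_bigr => s _.
congr (_ * _); rewrite (bigD1 (Y s)) //= eqxx mulr1 big1 ?addr0 // => t.
by rewrite eq_sym => /negbTE ->; rewrite mulr0.
Qed.

Lemma Ex_law_ge (T : finType) (Y : S -> T) (F p : T -> R) eps :
  (forall t, `|Pr (fun s => Y s == t) - p t| <= eps) ->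
  \sum_t F t * p t - eps * \sum_t `|F t| <= Ex (fun s => F (Y s)).
Proof.
move=> H; rewrite Ex_law mulr_sumr -sumrB; apply: ler_sum => t _.
have : `|F t * (Pr (fun s => Y s == t) - p t)| <= `|F t| * eps.
  by rewrite normrM ler_wpM2l.
rewrite ler_norml => /andP[+ _]; rewrite mulrBr.
move: (F t * Pr _) (F t * p t) (`|F t|) => a b c; lra.
Qed.

End Expectation.

Section Counting.
Variables (R : realType) (A J K Hy : finType) (j0 : J) (incidence : Hy -> J -> K).
Variables (D n : nat).
Hypothesis n0 : (0 < n)%N.
Hypothesis incidenceD : forall g : K -> R,
  \sum_h \sum_j g (incidence h j) = D%:R * \sum_k g k.
Variables (p : A -> R) (p2 : A -> A -> R).
Hypotheses (p0 : forall a, 0 < p a) (p1 : \sum_a p a = 1).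
Hypotheses (p20 : forall a b, 0 < p2 a b) (p2p : forall a, \sum_b p2 a b = p a).

Local Notation perms := {ffun Hy -> {ffun J -> {perm 'I_n}}}.
Local Notation colors := {ffun K -> {ffun 'I_n -> A}}.

(** The law of a family of colors for which, given the color at j0, the others are
    independent and each has joint law p2 with it. It maximizes the entropy among
    the laws with these pair marginals, and its logarithm involves only pairs. *)
Definition star_weight (t : {ffun J -> A}) : R :=
  p (t j0) * \prod_(j | j != j0) (p2 (t j0) (t j) / p (t j0)).

Lemma star_weight_gt0 t : 0 < star_weight t.
Proof. by rewrite mulr_gt0 // prodr_gt0 // => j _; rewrite divr_gt0. Qed.

Lemma star_weight_sum : \sum_t star_weight t = 1.
Proof.
rewrite (partition_big (fun t : {ffun J -> A} => t j0) xpredT) //= -p1.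
apply: eq_bigr => a _.
pose F j b : R := if j == j0 then (b == a)%:R else p2 a b / p a.
have -> : \sum_(t : {ffun J -> A} | t j0 == a) star_weight t =
    p a * \sum_(t : {ffun J -> A}) \prod_j F j (t j).
  rewrite mulr_sumr [LHS]big_mkcond; apply: eq_bigr => t _.
  rewrite (bigD1 j0) //= {1}/F eqxx; case: eqP => [ta|]; last by rewrite mul0r mulr0.
  rewrite mul1r /star_weight ta; congr (_ * _); apply: eq_bigr => j jj0.
  by rewrite /F (negbTE jj0).
rewrite -(bigA_distr_bigA F) (bigD1 j0) //= {1}/F eqxx (bigD1 a) //= eqxx.
rewrite [X in _ * ((_ + X) * _)]big1 ?addr0 ?mul1r => [|b /negbTE -> //].
rewrite big1 ?mulr1 // => j jj0; rewrite /F (negbTE jj0) -mulr_suml p2p divff //.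
by rewrite gt_eqF.
Qed.

Definition label (pi : perms) (x : colors) (h : Hy) (i : 'I_n) : {ffun J -> A} :=
  [ffun j => x (incidence h j) (pi h j i)].

(** A reference weight on pairs of a family of permutations, which glues centers
    to hubs, and a coloring of the centers. The denominator compensates for the
    permutations that produce the same labels at the hubs. *)
Definition log_weight (pi : perms) (x : colors) : R :=
  \sum_k \sum_i ln (p (x k i)) + \sum_h \sum_i ln (star_weight (label pi x h i))
  - \sum_h \sum_j ln (type_factor (x (incidence h j)))%:R.

Lemma type_factor_gt0 (X : finType) (s : X -> A) : (0 < type_factor s)%N.
Proof. by apply: prodn_gt0 => a; apply: fact_gt0. Qed.

Lemma expR_log_weight pi x : expR (log_weight pi x) =
  (\prod_k \prod_i p (x k i)) *
  \prod_h ((\prod_i star_weight (label pi x h i)) *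
           (\prod_j (type_factor (x (incidence h j)))%:R)^-1).
Proof.
rewrite /log_weight expRB expRD -mulrA !expR_sum; congr (_ * _).
  apply: eq_bigr => k _; rewrite expR_sum; apply: eq_bigr => i _.
  by rewrite lnK ?posrE.
rewrite -prodfV -big_split /=; apply: eq_bigr => h _; rewrite !expR_sum.
congr (_ * _^-1); first by apply: eq_bigr => i _; rewrite lnK ?posrE ?star_weight_gt0.
by apply: eq_bigr => j _; rewrite lnK ?posrE ?ltr0n ?type_factor_gt0.
Qed.

Lemma sum_perms_weight (x : colors) :
  \sum_(pi : perms) expR (log_weight pi x) <= \prod_k \prod_i p (x k i).
Proof.
rewrite (eq_bigr _ (fun pi _ => expR_log_weight pi x)).
rewrite -mulr_sumr ler_piMr ?prodr_ge0 // => [k _|].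
  by rewrite prodr_ge0 // => i _; apply: ltW.
pose G h (q : {ffun J -> {perm 'I_n}}) : R :=
  (\prod_i star_weight [ffun j => x (incidence h j) (q j i)]) *
  (\prod_j (type_factor (x (incidence h j)))%:R)^-1.
rewrite (eq_bigr (fun pi : perms => \prod_h G h (pi h))) //.
rewrite -(bigA_distr_bigA G); apply: prodr_ile1 => h _; apply/andP; split.
  apply: sumr_ge0 => q _; rewrite mulr_ge0 ?invr_ge0 ?prodr_ge0 // => i _.
  exact: ltW (star_weight_gt0 _).
rewrite -mulr_suml ler_pdivrMr ?mul1r; last first.
  by apply: prodr_gt0 => j _; rewrite ltr0n type_factor_gt0.
apply: (@sum_perm_weight _ _ R J (fun j => x (incidence h j)) star_weight).
  by move=> v; apply: ltW (star_weight_gt0 _).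
exact: star_weight_sum.
Qed.

Lemma sum_weight : \sum_(pi : perms) \sum_(x : colors) expR (log_weight pi x) <= 1.
Proof.
rewrite exchange_big /=; apply: (le_trans (ler_sum _ (fun x _ => sum_perms_weight x))).
rewrite -(bigA_distr_bigA (fun _ (y : {ffun 'I_n -> A}) => \prod_i p (y i))) /=.
rewrite big1 // => k _; rewrite -(bigA_distr_bigA (fun _ => p)) /=.
by rewrite big1.
Qed.

(** Each family of permutations contributes at least exp(-C) to the total weight,
    and there are #|Hy| * #|J| permutations in a family. *)
Lemma card_perms_le C : (forall pi : perms, exists x, - C <= log_weight pi x) ->
  (#|Hy| * #|J|)%:R * ln (n`!)%:R <= C.
Proof.
move=> H; have le1 : #|{: perms}|%:R * expR (- C) <= 1.
  apply: le_trans sum_weight; rewrite mulr_natl -sumr_const; apply: ler_sum => pi _.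
  have [x Hx] := H pi; rewrite (bigD1 x) //=.
  by rewrite (le_trans (y := expR (log_weight pi x))) ?ler_expR // lerDl sumr_ge0.
move: le1; rewrite !card_ffun card_Sn -expnM mulnC.
rewrite expRN ler_pdivrMr ?expR_gt0 // mul1r natrX => le1.
rewrite mulr_natl -lnXn ?ltr0n ?fact_gt0 // -ler_expR lnK // posrE.
by rewrite exprn_gt0 // ltr0n fact_gt0.
Qed.

Definition freq (s : 'I_n -> A) a : R := #|fiber s a|%:R / n%:R.

Lemma freqB s a c :
  freq s a - c = n%:R^-1 * (\sum_i ((s i == a)%:R - c)).
Proof.
rewrite sumrB sumr_const card_ord mulrBr -[c *+ n]mulr_natl.
rewrite mulKf ?pnatr_eq0 -?lt0n //; congr (_ - _); rewrite /freq mulrC; congr (_ * _).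
rewrite -natr_sum; congr (_%:R); rewrite -sum1_card big_mkcond.
by apply: eq_bigr => i _; rewrite inE; case: eqP.
Qed.

(** A random coloring of the centers which has almost the law p at each center
    and the law p2 at the pairs of centers around a hub, and whose color
    frequencies are concentrated. *)
Definition good_model (eps : R) (pi : perms) :=
  exists (S : finType) (w : S -> R) (X : S -> colors),
  [/\ forall s, 0 <= w s, \sum_s w s = 1,
      forall k i a, `|Pr w (fun s => X s k i == a) - p a| <= eps,
      forall h i j, j != j0 -> forall ab,
        `|Pr w (fun s => (X s (incidence h j0) (pi h j0 i), X s (incidence h j) (pi h j i)) == ab)
          - p2 ab.1 ab.2| <= eps &
      forall k a, Ex w (fun s => (freq (X s k) a - p a) ^+ 2) <= eps].

Definition entropy1 : R := - \sum_a p a * ln (p a).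
Definition entropy2 : R := - \sum_ab p2 ab.1 ab.2 * ln (p2 ab.1 ab.2).
(** An error eps in the laws changes the means of ln p, of ln p2 and, per point, of
    the logarithm of [type_factor] by at most eps times these constants. *)
Definition slope1 : R := \sum_a `|ln (p a)|.
Definition slope2 : R := \sum_ab `|ln (p2 ab.1 ab.2)|.
Definition type_slope : R := \sum_a (`|1 + ln (p a)| + (p a)^-1).

Section GoodModel.
Variables (eps : R) (pi : perms).
Variables (S : finType) (w : S -> R) (X : S -> colors).
Hypotheses (w0 : forall s, 0 <= w s) (w1 : \sum_s w s = 1).
Hypothesis marg1 : forall k i a, `|Pr w (fun s => X s k i == a) - p a| <= eps.
Hypothesis marg2 : forall h i j, j != j0 -> forall ab,
  `|Pr w (fun s => (X s (incidence h j0) (pi h j0 i), X s (incidence h j) (pi h j i)) == ab)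
          - p2 ab.1 ab.2| <= eps.
Hypothesis var1 : forall k a, Ex w (fun s => (freq (X s k) a - p a) ^+ 2) <= eps.

Lemma Ex_ln_p k i : - (entropy1 + eps * slope1) <= Ex w (fun s => ln (p (X s k i))).
Proof.
have := Ex_law_ge (fun a => ln (p a)) (marg1 k i).
rewrite /entropy1 /slope1 (eq_bigr (fun a => p a * ln (p a))) => [|a _]; last by rewrite mulrC.
by apply: le_trans; rewrite opprD opprK.
Qed.

Lemma Ex_ln_p_le k i : Ex w (fun s => ln (p (X s k i))) <= - entropy1 + eps * slope1.
Proof.
have := Ex_law_ge (fun a => - ln (p a)) (marg1 k i).
rewrite (ExN w (fun s => ln (p (X s k i)))) lerNr => h; apply: (le_trans h).
rewrite /entropy1 /slope1 opprB opprK addrC lerD //.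
  rewrite -sumrN le_eqVlt; apply/orP; left; apply/eqP; apply: eq_bigr => a _.
  by rewrite mulNr opprK mulrC.
by rewrite le_eqVlt (eq_bigr (fun a => `|ln (p a)|)) ?eqxx // => a _; rewrite normrN.
Qed.

Lemma Ex_ln_p2 h i j : j != j0 -> - (entropy2 + eps * slope2) <=
  Ex w (fun s => ln (p2 (X s (incidence h j0) (pi h j0 i)) (X s (incidence h j) (pi h j i)))).
Proof.
move=> jj0.
have := Ex_law_ge (fun ab => ln (p2 ab.1 ab.2)) (marg2 h i jj0).
rewrite /entropy2 /slope2 (eq_bigr (fun ab => p2 ab.1 ab.2 * ln (p2 ab.1 ab.2))).
  by apply: le_trans; rewrite opprD opprK.
by move=> a _; rewrite mulrC.
Qed.

(** The entropy of [star_weight]. *)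
Definition star_entropy : R := entropy1 + (#|J|.-1)%:R * (entropy2 - entropy1).
Definition star_slope : R := slope1 + (#|J|.-1)%:R * (slope1 + slope2).

Lemma Ex_ln_star_weight h i : - (star_entropy + eps * star_slope) <=
  Ex w (fun s => ln (star_weight (label pi (X s) h i))).
Proof.
have E s : ln (star_weight (label pi (X s) h i)) = ln (p (X s (incidence h j0) (pi h j0 i))) +
   \sum_j (if j != j0 then ln (p2 (X s (incidence h j0) (pi h j0 i)) (X s (incidence h j) (pi h j i)))
      - ln (p (X s (incidence h j0) (pi h j0 i))) else 0).
  rewrite /star_weight lnM ?posrE ?prodr_gt0 // => [|j _]; last by rewrite divr_gt0.
  rewrite !ffunE; congr (_ + _); rewrite [\prod_(j | _) _]big_mkcond ln_prod.
    apply: eq_bigr => j _; case: ifP => _; last by rewrite ln1.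
    by rewrite ln_div ?posrE // !ffunE.
  by move=> j; case: ifP => // _; rewrite divr_gt0.
rewrite /Ex (eq_bigr _ (fun s _ => congr1 (fun y => w s * y) (E s))) -/(Ex w _).
rewrite ExD Ex_sum.
apply: (@le_trans _ _ (- (entropy1 + eps * slope1) +
  \sum_j (if j != j0 then - (entropy2 + eps * slope2) - (- entropy1 + eps * slope1) else 0))).
  rewrite -big_mkcond sumr_const cardC1 -[X in _ <= _ + X]mulr_natl /star_entropy /star_slope.
  move: (_%:R) => m; rewrite le_eqVlt; apply/orP; left; apply/eqP; ring.
apply: lerD; first exact: Ex_ln_p.
apply: ler_sum => j _; case: ifP => jj0; last by rewrite Ex_cst.
by rewrite ExD ExN lerB // ?Ex_ln_p2 // Ex_ln_p_le.
Qed.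

Let N0 : 0 < n%:R :> R. Proof. by rewrite ltr0n. Qed.

Lemma Ex_freq k a : `|Ex w (fun s => freq (X s k) a - p a)| <= eps.
Proof.
rewrite /Ex (eq_bigr _ (fun s _ => congr1 (fun y => w s * y) (freqB (X s k) a (p a)))).
rewrite -/(Ex w _).
rewrite ExZ Ex_sum normrM ger0_norm ?invr_ge0 ?(ltW N0) //.
rewrite mulrC ler_pdivrMr //; apply: (le_trans (ler_norm_sum _ _ _)).
rewrite mulr_natr -[X in _ *+ X]card_ord -sumr_const; apply: ler_sum => i _.
by rewrite ExD Ex_cst // marg1.
Qed.

Lemma Ex_ln_type_factor k : Ex w (fun s => ln (type_factor (X s k))%:R) <=
  ln (n`!)%:R + #|A|%:R * (ln n%:R + 1) - n%:R * (entropy1 - eps * type_slope).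
Proof.
have := fun s => @ln_type_factor_le R A _ (X s k) p (freq (X s k)) _ p0.
rewrite card_ord => H0.
have {H0} H s := H0 n0 s (fun a => erefl).
apply: (le_trans (Ex_le w0 H)).
rewrite ExD Ex_cst // ExN lerD2l lerN2 ExZ ler_pM2l //.
rewrite !ExD !ExN Ex_cst // !Ex_sum -/entropy1 /type_slope -addrA lerD2l -opprD lerN2.
rewrite -big_split mulr_sumr; apply: ler_sum => a _ /=.
rewrite mulrDr; apply: lerD.
  rewrite ExZ; apply: (le_trans (ler_norm _)); rewrite normrM mulrC.
  by apply: ler_pM => //; apply: Ex_freq.
have -> : Ex w (fun s => (freq (X s k) a - p a) ^+ 2 / p a) =
    (p a)^-1 * Ex w (fun s => (freq (X s k) a - p a) ^+ 2).
  by rewrite -ExZ; apply: eq_bigr => s _; rewrite [_^-1 * _]mulrC.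
by rewrite mulrC ler_wpM2r ?invr_ge0 ?(ltW (p0 a)).
Qed.

End GoodModel.

(** The local laws determine the mean of [log_weight] up to small errors, and for
    each family of permutations some coloring reaches the mean. *)
Lemma counting eps : (forall pi, good_model eps pi) ->
  D%:R * #|K|%:R * (entropy1 - eps * type_slope) <=
  #|K|%:R * (entropy1 + eps * slope1) + #|Hy|%:R * (star_entropy + eps * star_slope)
   + D%:R * #|K|%:R * (#|A|%:R * ((ln n%:R + 1) / n%:R)).
Proof.
move=> good; have N0 : 0 < n%:R :> R by rewrite ltr0n.
pose C : R := n%:R * (#|K|%:R * (entropy1 + eps * slope1)) +
  n%:R * (#|Hy|%:R * (star_entropy + eps * star_slope)) +
  D%:R * (#|K|%:R * (ln (n`!)%:R + #|A|%:R * (ln n%:R + 1)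
     - n%:R * (entropy1 - eps * type_slope))).
have H : (#|Hy| * #|J|)%:R * ln (n`!)%:R <= C.
  apply: card_perms_le => pi; have [S [w [X [w0 w1 m1 m2 v1]]]] := good pi.
  have [s Hs] := Ex_attained w0 w1 (fun s => log_weight pi (X s)).
  exists (X s); apply: le_trans Hs.
  have -> : Ex w (fun s => log_weight pi (X s)) =
      \sum_k \sum_i Ex w (fun s => ln (p (X s k i))) +
      \sum_h \sum_i Ex w (fun s => ln (star_weight (label pi (X s) h i))) -
      D%:R * \sum_k Ex w (fun s => ln (type_factor (X s k))%:R).
    rewrite /log_weight ExD ExD ExN -(incidenceD (fun k => Ex w _)) !Ex_sum.
    by congr (_ + _ - _); apply: eq_bigr => h _; rewrite Ex_sum.
  rewrite /C !opprD; apply: lerD; first apply: lerD.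
  - apply: (@le_trans _ _ (\sum_(k : K) \sum_(i < n) - (entropy1 + eps * slope1))).
      rewrite !sumr_const card_ord -mulrnA -[leRHS]mulr_natl natrM.
      by rewrite le_eqVlt; apply/orP; left; apply/eqP; ring.
    by apply: ler_sum => k _; apply: ler_sum => i _; apply: Ex_ln_p.
  - apply: (@le_trans _ _ (\sum_(h : Hy) \sum_(i < n) - (star_entropy + eps * star_slope))).
      rewrite !sumr_const card_ord -mulrnA -[leRHS]mulr_natl natrM.
      by rewrite le_eqVlt; apply/orP; left; apply/eqP; ring.
    by apply: ler_sum => h _; apply: ler_sum => i _; apply: Ex_ln_star_weight.
  rewrite lerN2 ler_wpM2l // [leRHS]mulr_natl -sumr_const; apply: ler_sum => k _.
  exact: Ex_ln_type_factor.
have HK : (#|Hy| * #|J|)%:R = D%:R * #|K|%:R :> R.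
  have := incidenceD (fun=> 1); rewrite !sumr_const => <-.
  by rewrite -mulrnA mulnC.
rewrite HK /C in H; rewrite -(ler_pM2l N0).
set x := #|K|%:R * (entropy1 + _) in H *; set y := #|Hy|%:R * _ in H *.
set z := entropy1 - _ in H *; set l := ln n%:R + 1 in H *.
have -> : n%:R * (x + y + D%:R * #|K|%:R * (#|A|%:R * (l / n%:R))) =
    n%:R * x + n%:R * y + D%:R * #|K|%:R * (#|A|%:R * l).
  by field; rewrite gt_eqF.
move: H; move: (ln _) => F H; lra.
Qed.

End Counting.

(** * Random lifts of a tiling of the tree by balls *)

Local Open Scope nat_scope.

Section Tiling.
Variables (d rad : nat) (J : finType).
Variables (sh shV : J -> 'I_d -> 'I_d).
Hypotheses (shK : forall j, cancel (sh j) (shV j)) (shVK : forall j, cancel (shV j) (sh j)).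
Variable Hn : finType.

(** An edge that leaves a ball of radius rad is named by the reduced word read
    from the center of the ball across this edge. *)
Definition spoke : Type := {w : rad.+1.-tuple 'I_d | reduced w}.
HB.instance Definition _ := Finite.on spoke.

Local Notation ball := (rad.-bseq 'I_d).
Local Notation B := (J * ball + Hn)%type.

Definition to_spoke (s : seq 'I_d) : option spoke :=
  obind (fun t : rad.+1.-tuple 'I_d => insub t) (insub s).

Definition spoke_word (i : spoke) : seq 'I_d := val (val i).

Lemma to_spokeP s : (exists i, to_spoke s = Some i /\ spoke_word i = s) \/
  (to_spoke s = None /\ ~~ ((size s == rad.+1) && reduced s)).
Proof.
rewrite /to_spoke; case: insubP => [t -> /= ts|/negbTE ->]; last by right.
case: insubP => [i ri ti|]; last by rewrite ts => ->; right.
by left; exists i; split=> //; rewrite /spoke_word ti.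
Qed.

Lemma spoke_red i : reduced (spoke_word i). Proof. exact: (valP i). Qed.
Lemma size_spoke i : size (spoke_word i) = rad.+1. Proof. exact: size_tuple. Qed.

Lemma spoke_word_inj : injective spoke_word.
Proof. by move=> i i' E; apply/val_inj/val_inj. Qed.

Lemma to_spokeK i : to_spoke (spoke_word i) = Some i.
Proof.
case: (to_spokeP (spoke_word i)) => [[i' [-> /spoke_word_inj ->]]//|[_]].
by rewrite size_spoke eqxx spoke_red.
Qed.

Lemma reduced_map (f : 'I_d -> 'I_d) w : injective f ->
  reduced (map f w) = reduced w.
Proof.
move=> fi; rewrite /reduced sorted_map; apply: eq_sorted => a b /=.
by rewrite (inj_eq fi).
Qed.

Variables (X : 'I_d -> J -> spoke -> B) (Y : 'I_d -> Hn -> B).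

(** In the ball of class j the letters are renamed by [shV j], so that spokes of
    the same name in the balls of different classes may have different colors. *)
Definition out_spoke j c (w : ball) : option spoke :=
  to_spoke (map (shV j) (c :: w)).

(** The base graph consists of one ball for each class j and of the vertices in
    Hn. A move that leaves a ball follows a spoke and ends where X says. *)
Definition base_step (c : 'I_d) (b : B) : B :=
  match b with
  | inl (j, w) => if out_spoke j c w is Some i then X c j i else inl (j, tmul c w)
  | inr h => Y c h
  end.

Hypothesis XK : forall c j i w, out_spoke j c w = Some i -> base_step c (X c j i) = inl (j, w).
Hypothesis YK : forall c h, base_step c (Y c h) = inr h.

Lemma out_spoke_None j c w : out_spoke j c w = None <->
  ~~ ((size w == rad) && reduced (c :: w)).
Proof.
have E : ((size (map (shV j) (c :: w)) == rad.+1) && reduced (map (shV j) (c :: w)))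
       = ((size w == rad) && reduced (c :: w)).
  by rewrite size_map eqSS reduced_map //; apply: can_inj (shVK j).
rewrite /out_spoke -E; case: (to_spokeP (map (shV j) (c :: w))) => [[i [-> iE]]|[-> ->]//].
by split=> //; rewrite -iE size_spoke eqxx spoke_red.
Qed.

Lemma out_spoke_tmul j c w : out_spoke j c w = None -> out_spoke j c (tmul c w) = None.
Proof.
rewrite !out_spoke_None => nout; rewrite /tmul; case: ifP => // rw.
case: (leqP (size (lmul c w)) rad) => sl; last by rewrite /insubd insubN // -ltnNge.
have -> : insubd w (lmul c w) = lmul c w :> seq _ by rewrite val_insubd sl.
have := valP w; rewrite /=; case: (bseqval w) rw nout sl => [|c' w'] /= rw nout sl sw.
  by rewrite /reduced /= eqxx andbF.
move: sl; case: eqP => [->|_] /= sl; last by rewrite /reduced /= eqxx /= andbF.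
by rewrite negb_and neq_ltn sw.
Qed.

Lemma base_stepK c : involutive (base_step c).
Proof.
move=> [[j w]|h]; last exact: YK.
rewrite {2}/base_step; case E : (out_spoke j c w) => [i|]; first exact: XK.
by rewrite /base_step (out_spoke_tmul E) tmulK.
Qed.

Section Lift.
Variables (j0 : J) (om : spoke -> J -> seq 'I_d).
Variables (Q : finType) (t : 'I_d -> Q -> Q).
Hypothesis tK : forall c, involutive (t c).
Variables (n : nat) (pi : {ffun spoke * Q -> {ffun J -> {perm 'I_n}}}).

(** A permutation sits on the outer half-edge of each spoke. It is indexed by the
    name i of the spoke and by the position in Q of the center of class j0 at the
    same hub, which is reached by walking to the center of the ball and then
    along the inverse of om i j. *)
Definition gain (b : B) (c : 'I_d) (q : Q) : {perm 'I_n} :=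
  match b with
  | inl (j, w) => if out_spoke j c w is Some i
      then pi (i, act t (rev (om i j)) (act t (rev w) q)) j else 1%g
  | inr _ => 1%g
  end.

Definition lift_step (c : 'I_d) (z : B * Q * 'I_n) : B * Q * 'I_n :=
  let: (b, q, x) := z in
  (base_step c b, t c q,
   gain (base_step c b) c (t c q) (((gain b c q)^-1)%g x)).

Lemma lift_stepK c : involutive (lift_step c).
Proof.
by move=> [[b q] x]; rewrite /lift_step base_stepK tK permK permKV.
Qed.

Definition center (k : J * Q) (x : 'I_n) : B * Q * 'I_n := (inl (k.1, [bseq]), k.2, x).

Lemma lift_ball j q x (w : ball) : reduced w ->
  act lift_step w (center (j, q) x) = (inl (j, w), act t w q, x).
Proof.
case: w => w /=; elim: w => [|c w IH] sw rw.
  by rewrite /center; congr (inl (_, _), _, _); apply: val_inj.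
have rw' : reduced w := path_sorted rw; rewrite /= (IH (ltnW sw) rw').
pose bw : ball := Bseq (ltnW sw).
have E1 : out_spoke j c bw = None.
  by apply/out_spoke_None; rewrite /= negb_and neq_ltn (sw : size w < rad).
have E2 : tmul c bw = Bseq sw.
  apply: val_inj; rewrite /tmul rw' val_insubd.
  have -> : lmul c bw = c :: w.
    change (lmul c w = c :: w).
    by case: (w) rw => [|c' w'] //= /andP[/negbTE ->].
  by rewrite sw.
rewrite /lift_step /base_step E1 E2 /gain E1 invg1 perm1.
suff -> : out_spoke j c (Bseq sw) = None by rewrite perm1.
by rewrite -E2; apply: out_spoke_tmul.
Qed.

Lemma gain_leaf (i : spoke) j c (w : ball) q : out_spoke j c w = Some i ->
  gain (inl (j, w)) c (act t w (act t (om i j) q)) = pi (i, q) j.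
Proof. by move=> E; rewrite /gain E !act_revK. Qed.

End Lift.
End Tiling.

Section SpokeCount.
Variable d : nat.

Lemma sum_tuple_cons n (F : n.+1.-tuple 'I_d -> nat) :
  \sum_w F w = \sum_(c : 'I_d) \sum_(w : n.-tuple 'I_d) F [tuple of c :: w].
Proof.
rewrite pair_big /= (reindex (fun p : 'I_d * n.-tuple 'I_d => [tuple of p.1 :: p.2])) //.
exists (fun w : n.+1.-tuple 'I_d => (thead w, [tuple of behead w])) => [[c w] _|w _].
  by congr pair; apply: val_inj.
by rewrite [RHS]tuple_eta.
Qed.

Lemma card_spoke rad : (0 < d)%N -> #|{: spoke d rad}| = d * d.-1 ^ rad.
Proof.
move=> d0; have -> : #|{: spoke d rad}| = \sum_(w : rad.+1.-tuple 'I_d) (reduced w : nat).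
  by rewrite card_sig -sum1_card big_mkcond; apply: eq_bigr => w _; rewrite unfold_in.
elim: rad => [|rad IH].
  rewrite sum_tuple_cons expn0 muln1.
  rewrite (eq_bigr (fun=> 1)) ?sum1_card ?card_ord // => c _.
  rewrite (eq_bigr (fun=> 1)) => [|w _]; last by rewrite tuple0.
  by rewrite sum1_card card_tuple expn0.
rewrite expnS mulnCA -IH sum_tuple_cons exchange_big /= big_distrr /=.
apply: eq_bigr => w _; rewrite (tuple_eta w) /=.
set a := thead w; set v := behead w.
rewrite (eq_bigr (fun c => (c != a) * reduced (a :: v))); last first.
  by move=> c _; rewrite /reduced /=; case: (c != a); rewrite ?mul1n ?mul0n.
rewrite -big_distrl /=; congr (_ * _).
rewrite -big_mkcond sum1_card cardC1 card_ord //.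
Qed.

End SpokeCount.

(** Whatever the graph Q and the permutations pi, there is a finite graph Om over Q
    whose centers are grouped around hubs: the word om i j leads from the center
    of class j0 to that of class j, and the n sheets over these centers are
    matched by pi. *)
Definition lift_model (d : nat) (I J : finType) (j0 : J) (om : I -> J -> seq 'I_d) :=
  forall (Q : finType) (t : 'I_d -> Q -> Q), (forall c, involutive (t c)) ->
  forall n (pi : {ffun I * Q -> {ffun J -> {perm 'I_n}}}),
  exists (Om : finType) (sg : 'I_d -> Om -> Om) (f : Om -> Q)
    (ctr : J * Q -> 'I_n -> Om),
  [/\ forall c, involutive (sg c), forall c z, f (sg c z) = t c (f z),
      forall k k' x x', ctr k x = ctr k' x' -> k = k' /\ x = x' &
      forall i q j x, act sg (om i j) (ctr (j0, q) (pi (i, q) j0 x)) =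
        ctr (j, act t (om i j) q) (pi (i, q) j x)].

Lemma reduced_rev_cat d (a b : seq 'I_d) : reduced a -> reduced b ->
  (forall x a' y b', a = x :: a' -> b = y :: b' -> x != y) -> reduced (rev a ++ b).
Proof.
elim: a b => //= x a IH b ra rb ab; rewrite rev_cons cat_rcons.
apply: IH; first exact: path_sorted ra.
  by case: b rb ab => //= y b' rb ab; rewrite /reduced /= (ab x a y b').
by move=> y a' z b' ea [<- _]; move: ra; rewrite ea eq_sym => /andP[].
Qed.

(** Two classes of balls of radius l; a hub is an edge between two balls, which is
    the spoke of the same name in both. Centers at a hub are at distance 2 l + 1. *)
Section Odd.
Variables (d l : nat).

Local Notation spoke := (spoke d l).
Local Notation B := (bool * l.-bseq 'I_d + void)%type.

Definition odd_leaf (i : spoke) : l.-bseq 'I_d := insubd [bseq] (behead (spoke_word i)).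

Lemma odd_leafE i : odd_leaf i = behead (spoke_word i) :> seq _.
Proof. by rewrite val_insubd size_behead size_spoke leqnn. Qed.

Lemma spoke_behead i : exists c, spoke_word i = c :: odd_leaf i.
Proof.
rewrite odd_leafE; have := size_spoke i.
by case: (spoke_word i) => // c w _; exists c.
Qed.

Definition odd_cross (c : 'I_d) (j : bool) (i : spoke) : B := inl (~~ j, odd_leaf i).
Definition odd_hub (c : 'I_d) (h : void) : B := inr h.

Local Notation idsh := (fun (_ : bool) (c : 'I_d) => c).

Lemma odd_crossK c j i w : out_spoke idsh j c w = Some i ->
  base_step idsh odd_cross odd_hub c (odd_cross c j i) = inl (j, w).
Proof.
rewrite /out_spoke map_id => E; have iE : spoke_word i = c :: w.
  by case: (to_spokeP l (c :: w)) E => [[i' [-> <-]] [->]//|[->]].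
have wE : odd_leaf i = w by apply: val_inj; rewrite /= odd_leafE iE.
rewrite /odd_cross /base_step /out_spoke map_id wE E.
by rewrite /odd_cross negbK wE.
Qed.

Definition odd_word (i : spoke) (j : bool) : seq 'I_d :=
  if j then rev (odd_leaf i) ++ spoke_word i else [::].

Lemma odd_model : lift_model false odd_word.
Proof.
move=> Q t tK n pi.
pose sg := lift_step idsh odd_cross odd_hub odd_word t pi.
have sgK c : involutive (sg c).
  by apply: lift_stepK => //; exact: odd_crossK.
exists (B * Q * 'I_n)%type, sg, (fun z => z.1.2), (@center d l bool void Q n).
split=> //; first by move=> c [[b q] x].
  by move=> [j q] [j' q'] x x' [-> -> ->].
move=> i q [] x; last by [].
have [c iE] := spoke_behead i.
have [rw ri] : reduced (odd_leaf i) /\ reduced (spoke_word i).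
  by split; last exact: spoke_red; have := spoke_red i; rewrite iE => /path_sorted.
have oE j : out_spoke idsh j c (odd_leaf i) = Some i.
  by rewrite /out_spoke map_id -iE to_spokeK.
have lb j q' x' := @lift_ball d l bool idsh idsh (fun _ _ => erefl) void odd_cross odd_hub
  odd_word Q t n pi j q' x' _ rw.
rewrite /odd_word iE act_cat /= -/sg.
rewrite (lb false q) /sg /lift_step -/sg.
have E1 := gain_leaf void odd_word tK pi q (oE false).
have E2 := gain_leaf void odd_word tK pi q (oE true).
rewrite [act t (odd_word i false) q]/= in E1; rewrite E1 permK.
have bE : base_step idsh odd_cross odd_hub c (inl (false, odd_leaf i)) = inl (true, odd_leaf i).
  by rewrite /base_step oE.
have wE : t c (act t (odd_leaf i) q) = act t (odd_leaf i) (act t (odd_word i true) q).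
  by rewrite /odd_word iE act_cat /= act_Krev.
rewrite bE wE E2.
have := lb true (act t (odd_word i true) q) (pi (i, q) true x).
rewrite -/sg => <-; rewrite act_revK //.
by rewrite /odd_word iE.
Qed.

Lemma odd_word_size i : size (act lmul (odd_word i true) [::]) = l.*2.+1.
Proof.
have [c iE] := spoke_behead i; have ri := spoke_red i.
have sz : size (odd_leaf i) = l by rewrite odd_leafE size_behead size_spoke.
rewrite act_lmul_nil /odd_word; first by rewrite size_cat size_rev sz size_spoke addnS addnn.
apply: reduced_rev_cat => //; first by move: ri; rewrite iE => /path_sorted.
move=> a a' b b' ea; rewrite iE => -[<- _].
by move: ri; rewrite iE ea eq_sym => /andP[].
Qed.

End Odd.

(** Balls of radius l in d classes; a hub is a vertex joined to one ball of each
    class. Shifting the letters by the class makes the d edges at a hub of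
    different colors. Centers at a hub are at distance 2 l + 2. *)
Section Even.
Variables (d' l : nat).
Local Notation d := d'.+1.
Local Notation spoke := (spoke d l).
Local Notation B := ('I_d * l.-bseq 'I_d + spoke)%type.

Definition shift (j c : 'I_d) : 'I_d := (c + j)%R.
Definition unshift (j c : 'I_d) : 'I_d := (c - j)%R.
Lemma shiftK j : cancel (shift j) (unshift j). Proof. exact: addrK. Qed.
Lemma unshiftK j : cancel (unshift j) (shift j). Proof. exact: subrK. Qed.

Definition spoke_head (i : spoke) : 'I_d := head ord0 (spoke_word i).

Lemma spoke_wordE i : spoke_word i = spoke_head i :: behead (spoke_word i).
Proof. by have := size_spoke i; rewrite /spoke_head; case: (spoke_word i). Qed.

Definition even_leaf (j : 'I_d) (i : spoke) : l.-bseq 'I_d :=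
  insubd [bseq] (map (shift j) (behead (spoke_word i))).

Lemma even_leafE j i : even_leaf j i = map (shift j) (behead (spoke_word i)) :> seq _.
Proof. by rewrite val_insubd size_map size_behead size_spoke leqnn. Qed.

Definition even_cross (c j : 'I_d) (i : spoke) : B := inr i.
Definition even_hub (c : 'I_d) (i : spoke) : B :=
  inl ((c - spoke_head i)%R, even_leaf (c - spoke_head i)%R i).

Lemma out_spoke_leaf j i :
  out_spoke unshift j (shift j (spoke_head i)) (even_leaf j i) = Some i.
Proof.
rewrite /out_spoke even_leafE /= shiftK mapK; last exact: shiftK.
by rewrite -spoke_wordE to_spokeK.
Qed.

Lemma even_crossK c j i w : out_spoke unshift j c w = Some i ->
  base_step unshift even_cross even_hub c (even_cross c j i) = inl (j, w).
Proof.
rewrite /out_spoke => E.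
have iE : spoke_word i = map (unshift j) (c :: w).
  by case: (to_spokeP l (map (unshift j) (c :: w))) E => [[i' [-> <-]] [->]//|[->]].
rewrite /base_step /even_cross /even_hub.
have -> : (c - spoke_head i)%R = j by rewrite /spoke_head iE; apply: subKr.
congr (inl (_, _)); apply: val_inj; rewrite /= even_leafE iE /= mapK //.
exact: unshiftK.
Qed.

Lemma even_hubK c i : base_step unshift even_cross even_hub c (even_hub c i) = inr i.
Proof.
rewrite /even_hub /base_step; set j := (c - spoke_head i)%R.
have := out_spoke_leaf j i.
have -> : shift j (spoke_head i) = c by rewrite /shift addrC; apply: subrK.
by move=> ->.
Qed.

Lemma even_hub_shift j i : even_hub (shift j (spoke_head i)) i = inl (j, even_leaf j i).
Proof. by rewrite /even_hub /shift addrAC subrr add0r. Qed.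

Definition even_word (i : spoke) (j : 'I_d) : seq 'I_d :=
  if j == ord0 then [::] else rev (map (shift j) (spoke_word i)) ++ spoke_word i.

Lemma shift_spoke_word j i :
  map (shift j) (spoke_word i) = shift j (spoke_head i) :: even_leaf j i.
Proof. by rewrite spoke_wordE /= even_leafE. Qed.

Lemma even_leaf_red j i : reduced (even_leaf j i).
Proof.
have : reduced (map (shift j) (spoke_word i)).
  rewrite reduced_map; [exact: spoke_red|exact: can_inj (shiftK j)].
by rewrite shift_spoke_word => /path_sorted.
Qed.

Lemma even_model : lift_model ord0 even_word.
Proof.
move=> Q t tK n pi.
pose sg := lift_step unshift even_cross even_hub even_word t pi.
have sgK c : involutive (sg c).
  apply: lift_stepK => //; [exact: unshiftK|exact: even_crossK|exact: even_hubK].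
exists (B * Q * 'I_n)%type, sg, (fun z => z.1.2), (@center d l 'I_d spoke Q n).
split=> //; first by move=> c [[b q] x].
  by move=> [j q] [j' q'] x x' [-> -> ->].
move=> i q j x; rewrite /even_word; case: eqP => [->//|/eqP j0].
have lb j1 q' x' := @lift_ball d l 'I_d shift unshift unshiftK spoke even_cross
  even_hub even_word Q t n pi j1 q' x' _ (even_leaf_red j1 i).
have w0 : spoke_word i = shift ord0 (spoke_head i) :: even_leaf ord0 i.
  rewrite -shift_spoke_word -[LHS]map_id; apply: eq_map => c.
  by rewrite /shift addr0.
have bE j1 : base_step unshift even_cross even_hub (shift j1 (spoke_head i))
    (inl (j1, even_leaf j1 i)) = inr i by rewrite /base_step out_spoke_leaf.
have hub : act sg (spoke_word i) (center d l spoke (ord0, q) (pi (i, q) ord0 x)) =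
    (inr i, act t (spoke_word i) q, x).
  rewrite w0 /= -/sg (lb ord0 q) /sg /lift_step -/sg bE.
  have E1 := gain_leaf spoke even_word tK pi q (out_spoke_leaf ord0 i).
  rewrite [act t (even_word i ord0) q](_ : _ = q) // in E1.
  by rewrite E1 permK /= perm1.
rewrite (act_cat sg) hub shift_spoke_word rev_cons -cats1 (act_cat sg).
rewrite -[act sg [:: _] _]/(sg _ _).
have wE : t (shift j (spoke_head i)) (act t (spoke_word i) q) =
    act t (even_leaf j i) (act t (even_word i j) q).
  rewrite /even_word (negbTE j0) act_cat shift_spoke_word rev_cons -cats1 act_cat.
  by rewrite act_Krev.
have -> : sg (shift j (spoke_head i)) (inr i, act t (spoke_word i) q, x) =
   (inl (j, even_leaf j i), act t (even_leaf j i) (act t (even_word i j) q), pi (i, q) j x).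
  rewrite /sg /lift_step wE.
  rewrite [base_step _ _ _ _ (inr i)]even_hub_shift.
  rewrite (gain_leaf spoke even_word tK pi q (out_spoke_leaf j i)).
  by rewrite /= invg1 perm1.
have := lb j (act t (even_word i j) q) (pi (i, q) j x).
rewrite -/sg => <-; rewrite act_revK //.
by rewrite /even_word (negbTE j0) shift_spoke_word rev_cons -cats1.
Qed.

Lemma even_word_size i j : j != ord0 -> size (act lmul (even_word i j) [::]) = l.+1.*2.
Proof.
move=> j0; rewrite /even_word (negbTE j0) act_lmul_nil.
  by rewrite size_cat size_rev size_map size_spoke addnn.
apply: reduced_rev_cat; last 1 first.
- move=> a a' b b'; rewrite spoke_wordE /= => -[<- _] [<- _].
  by rewrite /shift -subr_eq0 addrAC subrr add0r.
- by rewrite reduced_map; [apply: spoke_red|apply: can_inj (shiftK j)].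
exact: spoke_red.
Qed.

End Even.

Local Open Scope ring_scope.

Lemma lift_model_ex (R : realType) d k : (2 < d)%N -> (0 < k)%N ->
  exists (I J : finType) (j0 : J) (om : I -> J -> seq 'I_d),
  [/\ lift_model j0 om, forall i, om i j0 = [::],
      forall i j, j != j0 -> size (act lmul (om i j) [::]) = k,
      (0 < #|I|)%N /\ (1 < #|J|)%N &
      corr_bound R d k = #|J|%:R / (#|I|%:R * (#|J|.-1)%:R)].
Proof.
move=> d2 k0; rewrite /corr_bound; case: ifP => ok.
  have kE : k = (k./2).*2.+1 by rewrite -[LHS]odd_double_half ok.
  exists (spoke d k./2), bool, false, (@odd_word d k./2); split.
  - exact: odd_model.
  - by [].
  - by move=> i [] // _; rewrite odd_word_size -kE.
  - split; last by rewrite card_bool.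
    rewrite card_spoke ?(ltnW (ltnW d2)) // muln_gt0 expn_gt0.
    by rewrite -subn1 subn_gt0 (ltnW d2) (ltnW (ltnW d2)).
  rewrite card_bool card_spoke ?(ltnW (ltnW d2)) // mulr1 natrM natrX.
  by rewrite -subn1 natrB // (ltnW (ltnW d2)).
case: d d2 => // d' d2.
have [l lE] : exists l, k./2 = l.+1.
  have := odd_double_half k; rewrite ok add0n => kk.
  by case E : (k./2) => [|l]; [move: k0; rewrite -kk E|exists l].
have kE : k = (l.+1).*2 by rewrite -lE -[LHS]odd_double_half ok.
exists (spoke d'.+1 l), 'I_d'.+1, ord0, (@even_word d' l); split.
- exact: even_model.
- by [].
- by move=> i j j0; rewrite even_word_size.
- split; last by rewrite card_ord (ltnW d2).
  by rewrite card_spoke // muln_gt0 expn_gt0 /= (ltnW d2 : (0 < d')%N).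
rewrite card_ord card_spoke // lE natrM natrX /=.
have -> : d'.+1%:R - 1 = d'%:R :> R by rewrite -(natrB _ (ltn0Sn _)) subn1.
have d0 : d'%:R != 0 :> R by rewrite pnatr_eq0 -lt0n; apply: (ltnW d2).
have d1 : d'.+1%:R != 0 :> R by rewrite pnatr_eq0.
by rewrite exprS; field; rewrite addrC natr1 d1 d0 expf_neq0.
Qed.

(** * Marginals of the Gibbs measure *)

Lemma prob_partition d (T : measurableType d) (R : realType) (P : probability T R)
    (I : finType) (f : T -> I) (E : set T) :
  measurable E -> (forall i, measurable (f @^-1` [set i])) ->
  fine (P E) = \sum_i fine (P (E `&` f @^-1` [set i])).
Proof.
move=> mE mf; have {1}-> : E = \bigcup_i (E `&` f @^-1` [set i]).
  by apply/seteqP; split=> [x Ex|x [i _ []]//]; exists (f x).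
rewrite measure_fin_bigcup; last 3 first.
- exact: finite_finset.
- apply/trivIsetP => i j _ _ /eqP ij; rewrite -subset0 => x [[_ /= fi] [_ /= fj]].
  by apply: ij; rewrite -fi fj.
- by move=> i _; apply: measurableI.
rewrite fsbig_finType -sum_fine // => i _.
by rewrite fin_num_measure //; apply: measurableI.
Qed.

Lemma small_log (R : realType) (eps K C : R) : 0 < eps -> 0 <= K -> 0 <= C ->
  exists n, [/\ (0 < n)%N, K / n%:R <= eps & C * ((ln n%:R + 1) / n%:R) <= eps].
Proof.
move=> e0 K0 C0; pose b := (K + 2 * C) / eps.
have b0 : 0 <= b by rewrite divr_ge0 ?(ltW e0) // addr_ge0 // mulr_ge0.
pose s := (Num.bound b).+1; have bs : b <= s%:R.
  have := archi_boundP b0; rewrite /s -natr1 => h; apply: ltW.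
  by apply: (lt_trans h); rewrite ltrDl.
have s0 : 0 < s%:R :> R by rewrite ltr0n.
have s1 : 1 <= s%:R :> R by rewrite ler1n.
have H : K + 2 * C <= eps * s%:R by rewrite [leRHS]mulrC -ler_pdivrMr.
(* A perfect square, because ln (s * s) = 2 * ln s is at most linear in s. *)
exists (s * s)%N; rewrite muln_gt0 /= natrM; split=> //.
  rewrite ler_pdivrMr ?mulr_gt0 // mulrA.
  apply: (@le_trans _ _ (eps * s%:R)); first by apply: le_trans H; rewrite lerDl mulr_ge0.
  by rewrite ler_peMr // mulr_ge0 ?(ltW e0) ?(ltW s0).
rewrite lnM ?posrE // mulrA ler_pdivrMr ?mulr_gt0 // mulrA.
have l2 : ln s%:R + ln s%:R + 1 <= 2 * s%:R :> R by have := le_lnD1 s0; lra.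
apply: (@le_trans _ _ (C * (2 * s%:R))); first by rewrite ler_wpM2l.
rewrite mulrA ler_wpM2r ?(ltW s0) //; apply: le_trans H.
by rewrite mulrC lerDr.
Qed.

Section GibbsMarginals.
Variables (R : realType) (d : nat) (V : choiceType) (e : rel V).
Hypothesis hT : regular_tree e d.
Variables (A : pointedFinType) (psi : V -> (V -> A) -> R).
Hypothesis hsym : symmetric_potential e psi.
Variable r : nat.
Hypothesis hrange : forall v, depends_on_ball e psi v r.
Variable mu : probability (borel_config V A) R.
Hypothesis hmu : unique_gibbs e psi r mu.

Definition event1 (x : V) (a : A) : set (V -> A) := [set om | om x = a].
Definition event2 (x y : V) (a b : A) : set (V -> A) := [set om | om x = a /\ om y = b].

Lemma cylinder_event1 x a : cylinder (event1 x a).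
Proof. by exists [:: x] => om om' E; rewrite /event1 /= E //; left. Qed.

Lemma cylinder_event2 x y a b : cylinder (event2 x y a b).
Proof.
exists [:: x; y] => om om' E; rewrite /event2 /= !E //; first by right; left.
by left.
Qed.

Definition marg x a : R := fine (mu (event1 x a)).
Definition joint x y a b : R := fine (mu (event2 x y a b)).

Lemma joint_sum x y a : \sum_b joint x y a b = marg x a.
Proof.
rewrite /marg (@prob_partition _ _ _ mu _ (fun om : borel_config V A => om y)); last 2 first.
- exact: cylinder_measurable (cylinder_event1 x a).
- by move=> b; apply: cylinder_measurable (cylinder_event1 y b).
by [].
Qed.

Lemma marg_sum x : \sum_a marg x a = 1.
Proof.
have := @prob_partition _ _ _ mu _ (fun om : borel_config V A => om x) setT
  measurableT (fun a => cylinder_measurable (cylinder_event1 x a)).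
rewrite probability_setT /= => ->; apply: eq_bigr => a _.
by rewrite setTI.
Qed.

Lemma base_coloring u : exists (word : V -> seq 'I_d) (nb : 'I_d -> V -> V),
  coloring e u word nb.
Proof.
have g0 : gdist e u u = size ([::] : seq 'I_d).
  by apply/eqP; rewrite -leqn0; apply: (gdist_le (n := 0)); exists [::].
by have [word [nb [col _]]] := tree_coloring hT (isT : reduced [::]) g0; exists word, nb.
Qed.

(** Conditional probabilities of a Gibbs measure are positive, and some boundary
    condition has positive probability. *)
Lemma joint_gt0 u v a b : u != v -> 0 < joint u v a b.
Proof.
move=> uv; have [word [nb col]] := base_coloring u.
pose L : set V := [set x | x = u \/ x = v].
have fL : finite_set L.
  apply: (@sub_finite_set _ _ ([set u] `|` [set v])); first by move=> x [->|->]; [left|right].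
  by rewrite finite_setU; split; apply: finite_set1.
have fB := finite_boundary hT col r.*2 fL.
have [T [f [[h fh hf] E]]] := @fsum_config V A R _ fB.
have mpr (t : boundary e r.*2 L -> A) :
    measurable ([set om | pr om = t] : set (borel_config V A)).
  exact: cylinder_measurable (pr_cylinder t fB).
have [t mt] : exists t : boundary e r.*2 L -> A, 0 < fine (mu [set om | pr om = t]).
  apply: contrapT => /forallNP H.
  have := @prob_partition _ _ _ mu _ (fun om : borel_config V A => h (pr om)) setT measurableT.
  have pE i : (fun om : borel_config V A => h (pr om)) @^-1` [set i] = [set om | pr om = f i].
    by apply/seteqP; split=> om /= E1; [rewrite -E1 hf|rewrite E1 fh].
  have mpE i : measurable ((fun om : borel_config V A => h (pr om)) @^-1` [set i]).
    by rewrite pE.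
  rewrite probability_setT /= => /(_ mpE).
  rewrite big1 => [/eqP|i _]; first by rewrite oner_eq0.
  rewrite setTI pE; apply/le_anti; rewrite fine_ge0 ?measure_ge0 // andbT.
  by rewrite leNgt; apply/negP/H.
pose s : L -> A := fun x => if val x == u then a else b.
have F0 : (0 < mu [set om | pr om = t])%E.
  by move: mt; case: (mu _) => [x||] //=; rewrite ?ltxx.
have := hmu.1 L fL s t F0; rewrite /cond_prob => cp.
have Z0 := partition_function_gt0 psi t fL.
have ms : 0 < fine (mu ([set om | pr om = s] `&` [set om | pr om = t])).
  rewrite -(pmulr_lgt0 _ (_ : 0 < (fine (mu [set om | pr om = t]))^-1)) ?invr_gt0 //.
  by rewrite cp divr_gt0 ?expR_gt0.
have mI := cylinder_measurable (cylinderI (pr_cylinder s fL) (pr_cylinder t fB)).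
have m2 := cylinder_measurable (cylinder_event2 u v a b).
apply: (lt_le_trans ms); rewrite /joint fine_le ?fin_num_measure //.
apply: le_measure; rewrite ?inE //.
move=> om [/= Es _]; split.
  have := congr1 (fun g => g (exist _ u (mem_set (or_introl erefl : L u)))) Es.
  by rewrite /pr /s /= eqxx.
have := congr1 (fun g => g (exist _ v (mem_set (or_intror erefl : L v)))) Es.
by rewrite /pr /s /= eq_sym (negbTE uv).
Qed.

Definition close_to_mu u v eps (m : set (V -> A) -> R) :=
  (forall a, `|m (event1 u a) - marg u a| <= eps) /\
  (forall a b, `|m (event2 u v a b) - joint u v a b| <= eps).

Lemma uniform_close u v eps : 0 < eps ->
  exists N, forall m, fa_prob m ->
    (forall L, finite_set L -> L `<=` ball_in e u N -> dlr e psi r m L) ->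
    close_to_mu u v eps m.
Proof.
move=> e0.
have [N1 H1] := choice (fun a => uniform_uniqueness hT hmu u (cylinder_event1 u a) e0).
have [N2 H2] := choice (fun ab : A * A =>
  uniform_uniqueness hT hmu u (cylinder_event2 u v ab.1 ab.2) e0).
exists (maxn (\max_a N1 a) (\max_ab N2 ab)) => m fm dm.
have mono M : (M <= maxn (\max_a N1 a) (\max_ab N2 ab))%N ->
    forall L, finite_set L -> L `<=` ball_in e u M -> dlr e psi r m L.
  move=> hM L fL LM; apply: dm => // x /LM; rewrite /ball_in /= => h.
  exact: leq_trans h hM.
split=> [a|a b].
  by apply: H1 => //; apply: mono; rewrite leq_max leq_bigmax.
by apply: (H2 (a, b)) => //; apply: mono; rewrite leq_max leq_bigmax orbT.
Qed.

End GibbsMarginals.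

(** * Local statistics of the finite Gibbs measures *)

Section FiniteModel.
Variables (R : realType) (d : nat) (V : choiceType) (e : rel V).
Hypothesis hT : regular_tree e d.
Variables (A : pointedFinType) (psi : V -> (V -> A) -> R).
Hypothesis hsym : symmetric_potential e psi.
Variable r : nat.
Hypothesis hrange : forall v, depends_on_ball e psi v r.
Variable mu : probability (borel_config V A) R.

Variables (u v : V) (eps : R) (N : nat).
Hypothesis closeN : forall m, fa_prob m ->
  (forall L, finite_set L -> L `<=` ball_in e u N -> dlr e psi r m L) ->
  close_to_mu mu u v eps m.

Variables (u0 : V) (word0 : V -> seq 'I_d) (nb0 : 'I_d -> V -> V).
Hypothesis col0 : coloring e u0 word0 nb0.
Variables (Om : finType) (sg : 'I_d -> Om -> Om).
Hypothesis sgK : forall c, involutive (sg c).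
Hypothesis girth : large_girth sg (N + r.*2).*2.

Local Notation conf := {ffun Om -> A}.
Local Notation gw := (gibbs_weight psi u0 word0 sg).
Definition total_weight : R := \sum_(x : conf) gw x.
Definition gibbs_prob (x : conf) : R := gw x / total_weight.

Lemma total_weight_gt0 : 0 < total_weight.
Proof.
rewrite /total_weight (bigD1 [ffun=> point]) //=.
by rewrite ltr_pwDl ?expR_gt0 // sumr_ge0 // => *; apply: expR_ge0.
Qed.

Lemma gibbs_prob_ge0 x : 0 <= gibbs_prob x.
Proof. by rewrite divr_ge0 ?expR_ge0 ?(ltW total_weight_gt0). Qed.

Lemma gibbs_prob_sum : \sum_x gibbs_prob x = 1.
Proof. by rewrite -mulr_suml divff // gt_eqF ?total_weight_gt0. Qed.

Section OneColoring.
Variables (word : V -> seq 'I_d) (nb : 'I_d -> V -> V).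
Hypothesis col : coloring e u word nb.
Variable y : Om.
Local Notation cov := (cover word sg y).

(** The pulled back law satisfies the Gibbs equations in a large ball, hence looks
    like mu near the root. *)
Lemma far_close (far : pred conf) :
  (forall x x' : conf,
    (forall z, (forall w, ball_in e u N w -> z <> cov w) -> x z = x' z) ->
    far x = far x') ->
  (exists x, far x) ->
  close_to_mu mu u v eps (far_law psi u0 word0 sg word y far).
Proof.
move=> fi fp; apply: closeN; first exact: fa_far_law.
by move=> L fL LN; apply: (dlr_far_law hT hsym hrange col0 sgK col girth fi fp).
Qed.

Lemma far_lawE (far : pred conf) (E : set (V -> A)) (P : pred conf) :
  (exists x, far x) -> (forall x, P x <-> E (fun w => x (cov w))) ->
  far_law psi u0 word0 sg word y far E * Pr gibbs_prob far =
  Pr gibbs_prob (fun x => far x && P x).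
Proof.
move=> ex PE.
have fm := far_mass_gt0 psi u0 word0 sg ex.
have T0 := total_weight_gt0.
have -> : Pr gibbs_prob far = far_mass psi u0 word0 sg far / total_weight.
  by rewrite /Pr /Ex mulr_suml; apply: eq_bigr => x _; rewrite /gibbs_prob mulrAC.
rewrite /far_law mulrA divfK ?gt_eqF // mulr_suml; apply: eq_bigr => x _.
rewrite /gibbs_prob /far_weight -!mulrA; congr (_ * _).
have -> : `[< E (fun w => x (cov w)) >] = P x.
  by apply/asboolP/idP => /PE.
by case: (far x); case: (P x); rewrite ?(mul0r, mul1r, mulr0, mulr1).
Qed.

Let all_ex : exists x : conf, xpredT x. Proof. by exists [ffun=> point]. Qed.

Let Pr_all : Pr gibbs_prob xpredT = 1.
Proof. exact: (Ex_cst gibbs_prob_sum). Qed.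

Lemma single_close a :
  `|Pr gibbs_prob (fun x => x y == a) - marg mu u a| <= eps.
Proof.
have [H _] := @far_close xpredT (fun _ _ _ => erefl) all_ex.
have <- := @far_lawE xpredT (event1 u a) (fun x => x y == a) all_ex.
  by rewrite Pr_all mulr1; apply: H.
by move=> x; rewrite /event1 /= (cover_root col) (rwP eqP).
Qed.

Lemma pair_close a b :
  `|Pr gibbs_prob (fun x => (x y, x (cov v)) == (a, b)) - joint mu u v a b| <= eps.
Proof.
have [_ H] := @far_close xpredT (fun _ _ _ => erefl) all_ex.
have <- := @far_lawE xpredT (event2 u v a b)
  (fun x => (x y, x (cov v)) == (a, b)) all_ex.
  by rewrite Pr_all mulr1; apply: H.
move=> x; rewrite /event2 /= (cover_root col).
by split=> [/eqP[-> ->]|[-> ->]]; rewrite ?eqxx.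
Qed.

(** Conditioning on the color of the far vertex y' still leaves a law close to mu
    near y. *)
Lemma far_decorrelated (y' : Om) a : 0 <= eps ->
  (forall w, ball_in e u N w -> y' <> cov w) ->
  `|Pr gibbs_prob (fun x => (x y' == a) && (x y == a)) -
    marg mu u a * Pr gibbs_prob (fun x => x y' == a)| <= eps.
Proof.
move=> eps0 far_y.
pose far (x : conf) := x y' == a.
have fp : exists x, far x by exists [ffun=> a]; rewrite /far ffunE.
have [] := @far_close far _ fp; first by move=> x x' H; rewrite /far H.
move=> close_a _; rewrite -(far_lawE (E := event1 u a) fp); last first.
  by move=> x; rewrite /event1 /= (cover_root col) (rwP eqP).
rewrite -mulrBl normrM.
have P0 : 0 <= Pr gibbs_prob far.
  by apply: sumr_ge0 => x _; rewrite mulr_ge0 ?gibbs_prob_ge0.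
rewrite (ger0_norm P0) -[leRHS]mulr1; apply: ler_pM => //.
rewrite -(Ex_cst gibbs_prob_sum 1); apply: Ex_le; first exact: gibbs_prob_ge0.
by move=> x; rewrite /far; case: eqP.
Qed.

End OneColoring.
End FiniteModel.

Section LocalStatistics.
Variables (R : realType) (d : nat) (V : choiceType) (e : rel V).
Hypothesis hT : regular_tree e d.
Variables (A : pointedFinType) (psi : V -> (V -> A) -> R).
Hypothesis hsym : symmetric_potential e psi.
Variable r : nat.
Hypothesis hrange : forall v, depends_on_ball e psi v r.
Variable mu : probability (borel_config V A) R.
Hypothesis hmu : unique_gibbs e psi r mu.

Lemma marg_ge0 x a : 0 <= marg mu x a.
Proof. by rewrite fine_ge0 ?measure_ge0. Qed.

Lemma marg_le1 x a : marg mu x a <= 1.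
Proof.
by rewrite -(marg_sum mu x) (bigD1 a) //= lerDl sumr_ge0 // => *; apply: marg_ge0.
Qed.

Section Model.
Variables (u v : V) (eps : R) (N : nat).
Hypothesis eps0 : 0 <= eps.
Hypothesis closeN : forall m, fa_prob m ->
  (forall L, finite_set L -> L `<=` ball_in e u N -> dlr e psi r m L) ->
  close_to_mu mu u v eps m.
Variables (u0 : V) (word0 : V -> seq 'I_d) (nb0 : 'I_d -> V -> V).
Hypothesis col0 : coloring e u0 word0 nb0.
Variables (Om : finType) (sg : 'I_d -> Om -> Om).
Hypothesis sgK : forall c, involutive (sg c).
Hypothesis girth : large_girth sg (N + r.*2).*2.

Local Notation w := (gibbs_prob psi u0 word0 sg).
Local Notation single := (single_close hT hsym hrange closeN col0 sgK girth).
Local Notation decor := (far_decorrelated hT hsym hrange closeN col0 sgK girth).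

Definition near_sites (y : Om) : {set Om} := [set act sg b y | b : N.-bseq 'I_d].

Lemma not_near (word : V -> seq 'I_d) (nb : 'I_d -> V -> V)
    (col : coloring e u word nb) (y y' : Om) : y' \notin near_sites y ->
  forall x, ball_in e u N x -> y' <> cover word sg y x.
Proof.
move=> /negP ny x ux E; apply: ny; apply/imsetP.
have sx : (size (word x) <= N)%N.
  have [b [sb ->]] := gdist_act hT col u x.
  rewrite (word_act col) (word_root col) (leq_trans (size_act_lmul _ _)) // addn0 sb.
  exact: ux.
by exists (Bseq sx).
Qed.

Lemma covariance_le (y y' : Om) a :
  Ex w (fun x => ((x y == a)%:R - marg mu u a) * ((x y' == a)%:R - marg mu u a)) <=
  2 * eps + (y' \in near_sites y)%:R.
Proof.
set p := marg mu u a; have p0 : 0 <= p by apply: marg_ge0.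
have p1 : p <= 1 by apply: marg_le1.
have w0 x : 0 <= w x by apply: gibbs_prob_ge0.
have w1 : \sum_x w x = 1 by apply: gibbs_prob_sum.
have [near|far] := boolP (y' \in near_sites y).
  apply: (@le_trans _ _ 1); last by rewrite lerDr mulr_ge0.
  rewrite -[leRHS](Ex_cst w1 1); apply: Ex_le => // x.
  have b1 (b : bool) : `|b%:R - p| <= 1 by rewrite ler_norml; case: b => /=; lra.
  by apply: (le_trans (ler_norm _)); rewrite normrM mulr_ile1 ?b1.
have [word [nb col]] := base_coloring hT u.
rewrite addr0.
have -> : Ex w (fun x => ((x y == a)%:R - p) * ((x y' == a)%:R - p)) =
   (Pr w (fun x => (x y' == a) && (x y == a)) - p * Pr w (fun x => x y' == a))
   - p * (Pr w (fun x => x y == a) - p).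
  rewrite -{5}(Ex_cst w1 p) /Pr -!(ExN, ExZ, ExD).
  apply: eq_bigr => x _; congr (_ * _).
  by case: (x y == a); case: (x y' == a) => /=; ring.
have := decor col a eps0 (not_near col far).
have := single col y a; rewrite -/p !ler_norml.
move: (Pr w _) (Pr w _ - _ * _) => s t /andP[s1 s2] /andP[t1 t2].
have : - (p * (s - p)) <= eps by nra.
lra.
Qed.

(** A vertex has a bounded number of near ones, whatever n is; all other
    covariances are small. *)
Lemma variance_le n (f : 'I_n -> Om) a : (0 < n)%N -> injective f ->
  Ex w (fun x => (freq R (fun i => x (f i)) a - marg mu u a) ^+ 2) <=
  2 * eps + #|{: N.-bseq 'I_d}|%:R / n%:R.
Proof.
move=> n0 fi; set p := marg mu u a; have N0 : 0 < n%:R :> R by rewrite ltr0n.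
have E (x : {ffun Om -> A}) : (freq R (fun i => x (f i)) a - p) ^+ 2 =
   (n%:R ^+ 2)^-1 * \sum_i \sum_j ((x (f i) == a)%:R - p) * ((x (f j) == a)%:R - p).
  rewrite freqB // exprMn exprVn; congr (_ * _); rewrite expr2 mulr_suml.
  by apply: eq_bigr => i _; rewrite mulr_sumr.
rewrite /Ex (eq_bigr _ (fun x _ => congr1 (fun z => w x * z) (E x))) -/(Ex w _).
rewrite ExZ Ex_sum mulrC ler_pdivrMr ?exprn_gt0 //.
apply: (@le_trans _ _ (\sum_(i < n) (2 * eps * n%:R + #|{: N.-bseq 'I_d}|%:R))).
  apply: ler_sum => i _; rewrite Ex_sum.
  apply: (@le_trans _ _ (\sum_(j < n) (2 * eps + (f j \in near_sites (f i))%:R))).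
    by apply: ler_sum => j _; apply: covariance_le.
  rewrite big_split /= sumr_const card_ord -[_ *+ n]mulr_natr lerD2l.
  rewrite -natr_sum ler_nat -big_mkcond sum1_card.
  rewrite -(card_imset _ fi); apply: (leq_trans _ (leq_imset_card _ _)).
  apply: subset_leq_card; apply/fintype.subsetP => _ /imsetP[j + ->].
  exact.
rewrite sumr_const card_ord -[_ *+ n]mulr_natr.
by rewrite le_eqVlt; apply/orP; left; apply/eqP; field; rewrite gt_eqF.
Qed.

End Model.
End LocalStatistics.

(** * The mutual information bound *)

Lemma sum_pair (R : nmodType) (T1 T2 : finType) (F : T1 * T2 -> R) :
  \sum_p F p = \sum_a \sum_b F (a, b).
Proof. by rewrite pair_bigA; apply: eq_bigr => -[]. Qed.

Section Inequality.
Variables (R : realType) (d : nat) (V : choiceType) (e : rel V).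
Hypothesis hT : regular_tree e d.
Variables (A : pointedFinType) (psi : V -> (V -> A) -> R).
Hypothesis hsym : symmetric_potential e psi.
Variable r : nat.
Hypothesis hrange : forall v, depends_on_ball e psi v r.
Variable mu : probability (borel_config V A) R.
Hypothesis hmu : unique_gibbs e psi r mu.

Variables (I J : finType) (j0 : J) (om : I -> J -> seq 'I_d) (k : nat).
Hypothesis hmodel : lift_model j0 om.
Hypothesis om0 : forall i, om i j0 = [::].
Hypothesis omk : forall i j, j != j0 -> size (act lmul (om i j) [::]) = k.
Variables (u v : V).
Hypothesis huv : gdist e u v = k.

Section Lift.
Variables (Q : finType) (t : 'I_d -> Q -> Q).
Hypothesis tK : forall c, involutive (t c).

Definition incidence (h : I * Q) (j : J) : J * Q := (j, act t (om h.1 j) h.2).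

Lemma incidence_sum (g : J * Q -> R) :
  \sum_h \sum_j g (incidence h j) = #|I|%:R * \sum_k g k.
Proof.
rewrite exchange_big /= sum_pair mulr_sumr.
apply: eq_bigr => j _; rewrite sum_pair /incidence /=.
rewrite mulr_natl -sumr_const; apply: eq_bigr => i _.
have bij : bijective (act t (om i j)).
  by exists (act t (rev (om i j))); [apply: act_revK|apply: act_Krev].
by rewrite [RHS](reindex _ (onW_bij _ bij)).
Qed.

Variables (eps : R) (N n : nat).
Hypotheses (eps0 : 0 < eps) (n0 : (0 < n)%N).
Hypothesis closeN : forall m, fa_prob m ->
  (forall L, finite_set L -> L `<=` ball_in e u N -> dlr e psi r m L) ->
  close_to_mu mu u v eps m.
Hypothesis girth : large_girth t (N + r.*2).*2.
Hypothesis nlarge : #|{: N.-bseq 'I_d}|%:R / n%:R <= eps.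

Lemma lift_good_model (pi : {ffun I * Q -> {ffun J -> {perm 'I_n}}}) :
  good_model j0 incidence (marg mu u) (joint mu u v) (3 * eps) pi.
Proof.
have [Om [sg [f [ctr [sgK fs ctr_inj ctr_act]]]]] := hmodel tK pi.
have gs : large_girth sg (N + r.*2).*2 := large_girth_equivariant fs girth.
have [word0 [nb0 col0]] := base_coloring hT u.
have eps3 : eps <= 3 * eps by move: eps0; lra.
exists {ffun Om -> A}, (gibbs_prob psi u word0 sg),
  (fun x : {ffun Om -> A} => [ffun k' => [ffun i => x (ctr k' i)]]); split.
- by move=> x; apply: gibbs_prob_ge0.
- exact: gibbs_prob_sum.
- move=> k' i a; apply: le_trans eps3.
  have := single_close hT hsym hrange closeN col0 sgK gs col0 (ctr k' i) a.
  rewrite (@eq_Pr _ _ _ (fun x : {ffun Om -> A} => x (ctr k' i) == a)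
    (fun x => [ffun k' => [ffun i => x (ctr k' i)]] k' i == a)) // => x.
  by rewrite !ffunE.
- move=> [i q] x j jj0 [a b]; apply: le_trans eps3.
  (* A coloring in which v has the word of the walk between the two centers. *)
  have guv : gdist e u v = size (act lmul (om i j) [::]) by rewrite omk.
  have [word [nb [col wv]]] := tree_coloring hT (act_reduced (om i j) (isT : reduced [::])) guv.
  have := pair_close hT hsym hrange closeN col0 sgK gs col (ctr (j0, q) (pi (i, q) j0 x)) a b.
  have -> : cover word sg (ctr (j0, q) (pi (i, q) j0 x)) v =
      ctr (incidence (i, q) j) (pi (i, q) j x).
    by rewrite /cover wv (act_act sgK) ctr_act.
  have <- : incidence (i, q) j0 = (j0, q) by rewrite /incidence om0.
  apply: le_trans; rewrite le_eqVlt; apply/orP; left; apply/eqP.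
  by congr (`|_ - _|); apply: eq_Pr => y; rewrite !ffunE.
- move=> k' a.
  have fi : injective (ctr k') by move=> x x' /ctr_inj[].
  have := variance_le hT hsym hrange (ltW eps0) closeN col0 sgK gs a n0 fi.
  move=> H; apply: le_trans (_ : _ <= 2 * eps + eps) _; last by move: eps0; lra.
  apply: le_trans (le_trans H _); last by rewrite lerD2l.
  rewrite le_eqVlt; apply/orP; left; apply/eqP; apply: eq_bigr => x _.
  congr (_ * (_ - _) ^+ 2); rewrite /freq; congr (_%:R / _).
  by apply: eq_card => i; rewrite !inE !ffunE.
Qed.

End Lift.

Hypotheses (uv : u != v) (J0 : (0 < #|J|)%N).

Local Notation h1 := (entropy1 (marg mu u)).
Local Notation h2 := (entropy2 (joint mu u v)).

Lemma marg_gt0 a : 0 < marg mu u a.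
Proof.
rewrite -(joint_sum mu u v a) (bigD1 point) //= ltr_pwDl ?(joint_gt0 hT hmu) //.
by apply: sumr_ge0 => b _; apply/ltW/(joint_gt0 hT hmu).
Qed.

(** The finite graphs have #|J| #|Q| classes of n centers with #|I| spokes each,
    and #|I| #|Q| classes of n hubs. Counting colorings on all of them, then
    letting n tend to infinity and the errors to zero, bounds the entropy seen
    along the spokes by the entropies at centers and hubs. *)
Lemma edge_vertex_inequality :
  #|I|%:R * #|J|%:R * h1 <=
  #|J|%:R * h1 + #|I|%:R * (h1 + (#|J|.-1)%:R * (h2 - h1)).
Proof.
set p := marg mu u; set p2 := joint mu u v.
pose c := #|J|%:R * (3 * slope1 p) + #|I|%:R * (3 * star_slope J p p2) + #|I|%:R * #|J|%:R
  + #|I|%:R * #|J|%:R * (3 * type_slope p).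
have c0 : 0 <= c.
  have l1 : 0 <= slope1 p by apply: sumr_ge0.
  have l2 : 0 <= slope2 p2 by apply: sumr_ge0.
  have lt : 0 <= type_slope p.
    by apply: sumr_ge0 => a _; rewrite addr_ge0 // invr_ge0 marg_ge0.
  have lR : 0 <= star_slope J p p2 by rewrite addr_ge0 // mulr_ge0 // addr_ge0.
  by rewrite !addr_ge0 // !mulr_ge0.
apply/ler_addgt0Pr => delta delta0.
pose eps := delta / (c + 1).
have c1 : 0 < c + 1 by rewrite ltr_wpDl.
have eps0 : 0 < eps by apply: divr_gt0.
have epsc : c * eps <= delta.
  rewrite /eps mulrCA ger_pMr //; rewrite ler_pdivrMr // mul1r; lra.
have [N closeN] := uniform_close hT hmu u v eps0.
pose M := (N + r.*2).*2.
have [n [n0 nK nA]] := @small_log R eps #|{: N.-bseq 'I_d}|%:R #|A|%:R eps0 (ler0n _ _) (ler0n _ _).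
have good pi := lift_good_model (@pmulK d M) eps0 n0 closeN (@pmul_girth d M) nK pi.
have := counting n0 (incidence_sum (@pmulK d M)) marg_gt0 (marg_sum mu u)
  (fun a b => joint_gt0 hT hmu a b uv) (joint_sum mu u v) good.
rewrite !card_prod !natrM -/p -/p2.
set q := #|{: {perm M.-bseq 'I_d}}|%:R.
have q0 : 0 < q by rewrite ltr0n; apply/card_gt0P; exists 1%g.
set i := #|I|%:R; set j := #|J|%:R => H.
rewrite -(ler_pM2l q0).
have {}H : q * (i * j * (entropy1 p - 3 * eps * type_slope p)) <=
  q * (j * (entropy1 p + 3 * eps * slope1 p) + i * (star_entropy J p p2 + 3 * eps * star_slope J p p2)
       + i * j * eps).
  apply: (le_trans (le_trans _ H)); first by rewrite le_eqVlt; apply/orP; left; apply/eqP; ring.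
  have : q * i * j * (#|A|%:R * ((ln n%:R + 1) / n%:R)) <= q * i * j * eps.
    by rewrite ler_wpM2l // !mulr_ge0.
  move: (_ / n%:R) => l hl; lra.
have : q * (c * eps) <= q * delta by rewrite ler_wpM2l // ltW.
rewrite /c -/i -/j; move: H; rewrite /star_entropy; lra.
Qed.

Lemma pair_information_le :
  #|I|%:R * (#|J|.-1)%:R * (2 * h1 - h2) <= #|J|%:R * h1.
Proof.
have := edge_vertex_inequality.
have -> : #|J|%:R = (#|J|.-1)%:R + 1 :> R by rewrite natr1 prednK.
lra.
Qed.

End Inequality.

Section Marginals.
Variables (R : realType) (d : nat) (V : choiceType) (e : rel V).
Hypothesis hT : regular_tree e d.
Variables (A : pointedFinType) (psi : V -> (V -> A) -> R).
Hypothesis hsym : symmetric_potential e psi.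
Variable r : nat.
Hypothesis hrange : forall v, depends_on_ball e psi v r.
Variable mu : probability (borel_config V A) R.
Hypothesis hmu : unique_gibbs e psi r mu.

(** Both marginals are approximated by the law of the color at one and the same
    vertex of a finite graph, covered by the tree in two ways. *)
Lemma marg_invariant u v a : marg mu u a = marg mu v a.
Proof.
apply/eqP; rewrite -subr_eq0 -normr_le0; apply/ler_addgt0Pl => eps eps0; rewrite addr0.
have e2 : 0 < eps / 2 by rewrite divr_gt0.
have [N1 c1] := uniform_close hT hmu u v e2.
have [N2 c2] := uniform_close hT hmu v u e2.
have g : large_girth (@pmul d (N1 + N2 + r.*2).*2) (N1 + N2 + r.*2).*2 by apply: pmul_girth.
have [word1 [nb1 col1]] := base_coloring hT u.
have [word2 [nb2 col2]] := base_coloring hT v.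
have g1 : large_girth (@pmul d (N1 + N2 + r.*2).*2) (N1 + r.*2).*2.
  by apply: large_girth_le g; rewrite leq_double leq_add2r leq_addr.
have g2 : large_girth (@pmul d (N1 + N2 + r.*2).*2) (N2 + r.*2).*2.
  by apply: large_girth_le g; rewrite leq_double leq_add2r leq_addl.
have h1 := single_close hT hsym hrange c1 col1 (@pmulK _ _) g1 col1 1%g a.
have h2 := single_close hT hsym hrange c2 col1 (@pmulK _ _) g2 col2 1%g a.
move: h1 h2; rewrite !ler_norml => /andP[a1 a2] /andP[b1 b2]; lra.
Qed.

End Marginals.

Section EntropyLaw.
Variables (R : realType) (dO : measure_display) (O : measurableType dO).
Variable P : probability O R.

Lemma entropy_diag (S : finType) (Z : O -> S) :
  entropy P (fun o => (Z o, Z o)) = entropy P Z.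
Proof.
rewrite /entropy; congr (- _); rewrite sum_pair; apply: eq_bigr => a _.
rewrite (bigD1 a) //= big1 ?addr0 => [|b ba].
  have -> // : (fun o => (Z o, Z o)) @^-1` [set (a, a)] = Z @^-1` [set a].
  by apply/seteqP; split=> o /= => [[->]|->].
have -> : (fun o => (Z o, Z o)) @^-1` [set (a, b)] = set0.
  by rewrite -subset0 => o /= [-> ab]; rewrite ab eqxx in ba.
by rewrite measure0 mul0r.
Qed.

End EntropyLaw.

Theorem theorem1 (R : realType) (d : nat) (hd : (2 < d)%N)
  (V : choiceType) (e : rel V) (hT : regular_tree e d)
  (A : pointedFinType) (psi : V -> (V -> A) -> R)
  (hlocal : local_potential e psi) (hsym : symmetric_potential e psi)
  (r : nat) (hr : (0 < r)%N) (hrange : forall v, depends_on_ball e psi v r)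
  (mu : probability (borel_config V A) R) (hmu : unique_gibbs e psi r mu)
  (dO : measure_display) (O : measurableType dO) (P : probability O R)
  (X : {RV P >-> borel_config V A})
  (hX : forall B : set (borel_config V A), measurable B ->
          distribution P X B = mu B)
  (k : nat) (u v : V) (huv : gdist e u v = k) :
  mutual_info P (fun o => X o u) (fun o => X o v)
    <= corr_bound R d k * entropy P (fun o => X o v).
Proof.
case: k huv => [|k] huv.
  have [word [nb col]] := base_coloring hT u.
  have uv := gdist0 hT col huv; subst v.
  rewrite /mutual_info entropy_diag /corr_bound /= expr0 divr1 mul1r.
  by rewrite addrK.
have entropy1E x : entropy P (fun o => X o x) = entropy1 (marg mu x).
  congr (- _); apply: eq_bigr => a _.
  by rewrite /marg -(hX _ (cylinder_measurable (cylinder_event1 x a))).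
have entropy2E : entropy P (fun o => (X o u, X o v)) = entropy2 (joint mu u v).
  congr (- _); apply: eq_bigr => -[a b] _.
  rewrite /joint -(hX _ (cylinder_measurable (cylinder_event2 u v a b))).
  rewrite /distribution /pushforward /=.
  have -> // : (fun o => (X o u, X o v)) @^-1` [set (a, b)] = X @^-1` event2 u v a b.
  by apply/seteqP; split=> o /= [E1 E2]; [split|congr pair].
have mE : marg mu v = marg mu u.
  by apply/funext => a; apply: (marg_invariant hT hsym hrange hmu).
rewrite /mutual_info !entropy1E entropy2E mE.
have [I [J [j0 [om [hm om0 omk [I0 J0] ->]]]]] := lift_model_ex R hd (isT : (0 < k.+1)%N).
have uv : u != v.
  apply: contra_eqN huv => /eqP ->; have [word [nb col]] := base_coloring hT v.
  by rewrite (gdistxx col).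
have := pair_information_le hT hsym hrange hmu hm om0 omk huv uv (ltnW J0).
have pos : 0 < #|I|%:R * (#|J|.-1)%:R :> R.
  by rewrite mulr_gt0 ?ltr0n //; case: #|J| J0 => [|[]].
move=> H; rewrite mulrAC ler_pdivlMr // mulrC; apply: le_trans H.
by rewrite le_eqVlt; apply/orP; left; apply/eqP; ring.
Qed.
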